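(* Fix an integer balancing parameter $\alpha \ge 2$ (a constant). Let $\pi$ be a permutation of $\{0,\dots,n-1\}$ with $r$ input intervals, given by the arrays $P[0..r]$, $P_\pi[0..r-1]$ and $\tau[0..r-1]$ as defined in the context. Then a balanced move structure $\mathrm{MOVE}_\pi$ for $\pi$ can be constructed in $O(r)$ time and $O(r)$ space.
   Context: Model: word RAM with words of $\Theta(\log n)$ bits; space is measured in words. For a permutation $\pi$ of $\{0,\dots,n-1\}$, let $P$ be the sorted set of the $r$ positions $i$ such that $i=0$ or $\pi(i-1)\neq \pi(i)-1$, extended with $P[r]=n$; the $j$-th input interval is $[P[j],P[j+1])$, and $\pi(i)=\pi(P[j])+(i-P[j])$ for $i$ in it. Let $P_\pi[j]=\pi(P[j])$ for $j\in[0,r)$. Let $Q$ be the sorted elements of $P_\pi$ extended with $Q[r]=n$ (output intervals $[Q[k],Q[k+1])$), and let $\tau:[0,r)\to[0,r)$ be given by $\tau(j)=k$ iff $P_\pi[j]=Q[k]$. For a set $A$ and value $x$, $A.\mathrm{rank}(x)$ is the index (in sorted order) of the largest element of $A$ that is $\le x$. A balanced move structure $\mathrm{MOVE}_\pi$ consists of a sorted set $P'\supseteq P$ of $r'=O(r)$ positions (with $P'[r']=n$) such that $\pi$ maps each interval $[P'[j],P'[j+1])$ contiguously, together with arrays $P'_\pi[j]=\pi(P'[j])$ and $P'_{\mathrm{rank}(\pi)}[j]=P'.\mathrm{rank}(\pi(P'[j]))$, with the property that, letting $Q'$ be the sorted elements of $P'_\pi$ extended with $n$, for any consecutive elements $q_s<q_e$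 of $Q'$ we have $|(q_s,q_e)\cap P'|<2\alpha$ (in particular $O(1)$). Consequently a move query — given $i\in[0,n)$ and $j=P'.\mathrm{rank}(i)$, return $\pi(i)$ and $P'.\mathrm{rank}(\pi(i))$ — is answered in $O(1)$ worst-case time by computing $\pi(i)=P'_\pi[j]+(i-P'[j])$ and scanning $P'$ forward from index $P'_{\mathrm{rank}(\pi)}[j]$. *)

(* Defs.v *)
From mathcomp Require Import all_boot all_fingroup.

Set Implicit Arguments.
Unset Strict Implicit.
Unset Printing Implicit Defensive.

(* Positions are natural numbers, so that they can be stored in memory words;
   the value outside [0, n) is junk and is never used below. *)
Definition papply n (pi : 'S_n) (i : nat) : nat :=
  if insub i is Some k then nat_of_ord (pi k) else 0.

(* [pi(i-1) <> pi(i) - 1] over the integers, written without subtraction. *)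
Definition starts_interval n (pi : 'S_n) (i : nat) : bool :=
  (i == 0) || ((papply pi i.-1).+1 != papply pi i).

Definition starts n (pi : 'S_n) : seq nat :=
  [seq i <- iota 0 n | starts_interval pi i].

Definition nb_intervals n (pi : 'S_n) : nat := size (starts pi).

Definition image_of n (pi : 'S_n) (A : seq nat) : seq nat :=
  [seq papply pi i | i <- A].

Definition P_arr n (pi : 'S_n) : seq nat := rcons (starts pi) n.
Definition Ppi_arr n (pi : 'S_n) : seq nat := image_of pi (starts pi).
Definition Q_arr n (pi : 'S_n) : seq nat := rcons (sort leq (Ppi_arr pi)) n.

(* The entries of [Q_arr pi] are distinct, so [index] gives the only [k] with
   [Ppi_arr pi]_j = [Q_arr pi]_k. *)
Definition tau_arr n (pi : 'S_n) : seq nat :=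
  [seq index x (Q_arr pi) | x <- Ppi_arr pi].

(* [A] is increasing: [k] is the index of its largest element [<= x]. *)
Definition is_rank (A : seq nat) (x k : nat) : Prop :=
  [/\ k < size A, nth 0 A k <= x
    & forall l, l < size A -> nth 0 A l <= x -> nth 0 A l <= nth 0 A k].

(* [A] lists the [r'] positions of P' without the sentinel [n]; [B] and [C] are
   the two arrays of images and of ranks of images. The requirement
   [r' = O(r)] is [size A <= cr * r]. *)
Record balanced_move_structure (alpha cr n : nat) (pi : 'S_n)
    (A B C : seq nat) : Prop := BalancedMoveStructure {
  bms_sorted : sorted ltn A;
  bms_lt : forall p, p \in A -> p < n;
  bms_sub : {subset starts pi <= A};
  bms_size : size A <= cr * nb_intervals pi;
  bms_contiguous : forall j i, j < size A ->
    nth 0 (rcons A n) j <= i < nth 0 (rcons A n) j.+1 ->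
    papply pi i = papply pi (nth 0 A j) + (i - nth 0 A j);
  bms_image : B = image_of pi A;
  bms_rank_size : size C = size A;
  bms_rank : forall j, j < size A ->
    is_rank A (papply pi (nth 0 A j)) (nth 0 C j);
  bms_balanced : forall k, k < size A ->
    let Q' := rcons (sort leq (image_of pi A)) n in
    count (fun p => nth 0 Q' k < p < nth 0 Q' k.+1) (rcons A n) < 2 * alpha
}.

Inductive binop : Set :=
  | OpAdd | OpSub | OpMul | OpDiv | OpMod | OpAnd | OpOr | OpXor | OpShl | OpShr.

(* Registers and code addresses are given by their number. *)
Inductive instr : Set :=
  | IConst (d v : nat)               (* R_d := v *)
  | IMove (d a : nat)                (* R_d := R_a *)
  | IOp (o : binop) (d a b : nat)    (* R_d := R_a o R_b *)
  | ILoad (d a : nat)                (* R_d := M[R_a] *)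
  | IStore (a s : nat)               (* M[R_a] := R_s *)
  | IJump (l : nat)
  | IJumpEq (a b l : nat)            (* if R_a = R_b then goto l *)
  | IJumpLt (a b l : nat).           (* if R_a < R_b then goto l *)

Record state : Type := State {
  st_pc : nat;
  st_reg : nat -> nat;
  st_mem : nat -> nat
}.

Definition upd (f : nat -> nat) (a v : nat) : nat -> nat :=
  fun x => if x == a then v else f x.

(* Arithmetic on [w]-bit words. Division by zero is total as in [divn]. *)
Definition eval_binop (w : nat) (o : binop) (x y : nat) : nat :=
  (match o with
   | OpAdd => x + y
   | OpSub => x + 2 ^ w - y
   | OpMul => x * y
   | OpDiv => x %/ y
   | OpMod => x %% y
   | OpAnd => Nat.land x y
   | OpOr => Nat.lor x y
   | OpXor => Nat.lxor x y
   | OpShl => x * 2 ^ y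
   | OpShr => x %/ 2 ^ y
   end) %% 2 ^ w.

Definition set_reg (st : state) (d v : nat) : state :=
  State (st_pc st).+1 (upd (st_reg st) d v) (st_mem st).

Definition goto_if (b : bool) (l : nat) (st : state) : state :=
  State (if b then l else (st_pc st).+1) (st_reg st) (st_mem st).

(* The machine has [S] memory words, at addresses [0, S); any access outside
   this range is a fault ([None]). *)
Definition exec_instr (w S : nat) (i : instr) (st : state) : option state :=
  match i with
  | IConst d v => Some (set_reg st d (v %% 2 ^ w))
  | IMove d a => Some (set_reg st d (st_reg st a))
  | IOp o d a b =>
      Some (set_reg st d (eval_binop w o (st_reg st a) (st_reg st b)))
  | ILoad d a =>
      if st_reg st a < S
      then Some (set_reg st d (st_mem st (st_reg st a)))
      else None
  | IStore a s =>
      if st_reg st a < S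
      then Some (State (st_pc st).+1 (st_reg st)
                  (upd (st_mem st) (st_reg st a) (st_reg st s)))
      else None
  | IJump l => Some (goto_if true l st)
  | IJumpEq a b l => Some (goto_if (st_reg st a == st_reg st b) l st)
  | IJumpLt a b l => Some (goto_if (st_reg st a < st_reg st b) l st)
  end.

Definition program := seq instr.

(* The machine halts when control leaves the program. *)
Definition halted (prog : program) (st : state) : bool := size prog <= st_pc st.

Definition step (w S : nat) (prog : program) (st : state) : option state :=
  if halted prog st then None
  else exec_instr w S (nth (IJump 0) prog (st_pc st)) st.

Fixpoint steps (w S : nat) (prog : program) (t : nat) (st : state)
    : option state :=
  if t is t'.+1 then obind (steps w S prog t') (step w S prog st) else Some st.

Definition word_state (w : nat) (st : state) : Prop :=
  (forall i, st_reg st i < 2 ^ w) /\ (forall a, st_mem st a < 2 ^ w).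

Definition array_at (m : nat -> nat) (a : nat) (s : seq nat) : Prop :=
  forall i, i < size s -> m (a + i) = nth 0 s i.

(* R_0 = r, and the arrays P[0..r], P_pi[0..r-1], tau[0..r-1] are stored
   consecutively from address 0. All other registers and memory cells hold
   arbitrary words. *)
Definition input_state (w n : nat) (pi : 'S_n) (st : state) : Prop :=
  [/\ word_state w st, st_pc st = 0, st_reg st 0 = nb_intervals pi
    & array_at (st_mem st) 0 (P_arr pi ++ Ppi_arr pi ++ tau_arr pi)].

(* R_0 = r', and R_1, R_2, R_3 are the base addresses of the arrays P'[0..r'],
   P'_pi[0..r'-1], P'_rank(pi)[0..r'-1], which lie in the [S] memory words. *)
Definition output_state (S alpha cr n : nat) (pi : 'S_n) (st : state) : Prop :=
  exists A B C : seq nat,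
  [/\ balanced_move_structure alpha cr pi A B C,
      st_reg st 0 = size A,
      st_reg st 1 + size (rcons A n) <= S /\
        array_at (st_mem st) (st_reg st 1) (rcons A n),
      st_reg st 2 + size B <= S /\ array_at (st_mem st) (st_reg st 2) B
    & st_reg st 3 + size C <= S /\ array_at (st_mem st) (st_reg st 3) C].

(* Main.v *)
Require Import Defs.
From mathcomp Require Import all_boot all_fingroup.
From mathcomp Require Import zify.

Set Implicit Arguments.
Unset Strict Implicit.
Unset Printing Implicit Defensive.

(* Let A be a set of breakpoints of pi containing the interval starts and the
   sentinel n, and let Q = pi(A). The nodes A u Q are kept in one doubly linked
   list, with links between p and pi(p). An input interval and its image are
   traversed in lock step, as far as the third offset at which either of them
   contains a node; if there is one, both are cut at the second such offset.

   One of the two cut points is already a node, so a cut adds one breakpoint and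
   at most one node, and |A u Q| - |A| <= r is preserved. Both halves of a cut
   pair still contain a node in their interior, so every breakpoint that is not
   an interval start can be charged to such a node; each node of A u Q outside
   A n Q is charged at most once, whence |A| <= 3r + 1 and there are at most 2r
   cuts.

   Pairs to be examined are kept on a stack. A cut can only make the pair
   containing the new node crowded. It is found by walking back at most three
   nodes: if this does not reach the start of the pair, the pair was crowded
   before and is already on the stack. Once the stack is empty, every output
   interval contains at most two input breakpoints in its interior, which is
   less than 2 alpha. *)
(** * A structured language compiled to the machine *)

Lemma upd_same f a v : upd f a v a = v.
Proof. by rewrite /upd eqxx. Qed.

Lemma upd_diff f a v b : b != a -> upd f a v b = f b.
Proof. by rewrite /upd => /negbTE ->. Qed.

Lemma upd_at f a v b : b = a -> upd f a v b = v.
Proof. by move=> ->; exact: upd_same. Qed.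

Lemma upd_notin f a v (s : seq nat) i :
  i \notin s -> a \in s -> upd f a v i = f i.
Proof. by move=> hi ha; rewrite upd_diff //; apply: contraNneq hi => ->. Qed.

Lemma notin_sub (s s' : seq nat) i : all (mem s) s' -> i \notin s -> i \notin s'.
Proof. by move=> /allP h; apply: contra => /h. Qed.

Ltac rd_upd := repeat first
  [ rewrite upd_at; [|by lia] | rewrite upd_diff; [|by lia] ].

(* Scratch register of the compiled code. *)
Notation tmp := 30 (only parsing).

Inductive op : Set :=
  | OSet (d v : nat) | OMov (d a : nat) | OAdd (d a b : nat)
  | OAddI (d a k : nat) | OMulI (d a k : nat) | OSub (d a b : nat)
  | OLd (d a k : nat)    (* R_d := M[R_a + k] *)
  | OSt (a k s : nat).   (* M[R_a + k] := R_s *)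

Inductive cond : Set := CLt (a b : nat) | CZ (a : nat).

Inductive cmd : Set :=
  | Skip | Op (o : op) | Seq (a b : cmd)
  | If (c : cond) (a b : cmd) | While (c : cond) (b : cmd).

Definition op_code (o : op) : seq instr :=
  match o with
  | OSet d v => [:: IConst d v]
  | OMov d a => [:: IMove d a]
  | OAdd d a b => [:: IOp OpAdd d a b]
  | OAddI d a k => [:: IConst tmp k; IOp OpAdd d a tmp]
  | OMulI d a k => [:: IConst tmp k; IOp OpMul d a tmp]
  | OSub d a b => [:: IOp OpSub d a b]
  | OLd d a k => [:: IConst tmp k; IOp OpAdd tmp a tmp; ILoad d tmp]
  | OSt a k s => [:: IConst tmp k; IOp OpAdd tmp a tmp; IStore tmp s]
  end.

Definition cond_code (c : cond) (l : nat) : seq instr :=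
  match c with
  | CLt a b => [:: IJumpLt a b l]
  | CZ a => [:: IConst tmp 0; IJumpEq a tmp l]
  end.

Definition cond_size (c : cond) : nat := if c is CLt _ _ then 1 else 2.

Fixpoint csize (c : cmd) : nat :=
  match c with
  | Skip => 0
  | Op o => size (op_code o)
  | Seq a b => csize a + csize b
  | If c a b => cond_size c + csize b + 1 + csize a
  | While c b => cond_size c + 1 + csize b + 1
  end.

Fixpoint compile (off : nat) (c : cmd) : seq instr :=
  match c with
  | Skip => [::]
  | Op o => op_code o
  | Seq a b => compile off a ++ compile (off + csize a) b
  | If c a b =>
      let l := off + cond_size c + csize b + 1 in
      cond_code c l ++ compile (off + cond_size c) b ++
      [:: IJump (l + csize a)] ++ compile l a
  | While c b =>
      let l := off + cond_size c + 1 in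
      cond_code c l ++ [:: IJump (l + csize b + 1)] ++ compile l b ++
      [:: IJump off]
  end.

Definition op_wf (o : op) : bool :=
  match o with
  | OSet _ _ => true
  | OMov _ a => a != tmp
  | OAdd _ a b | OSub _ a b => (a != tmp) && (b != tmp)
  | OAddI _ a _ | OMulI _ a _ | OLd _ a _ => a != tmp
  | OSt a _ s => (a != tmp) && (s != tmp)
  end.

Definition cond_wf (c : cond) : bool :=
  match c with CLt a b => (a != tmp) && (b != tmp) | CZ a => a != tmp end.

Fixpoint wf (c : cmd) : bool :=
  match c with
  | Skip => true
  | Op o => op_wf o
  | Seq a b => wf a && wf b
  | If c a b => [&& cond_wf c, wf a & wf b]
  | While c b => cond_wf c && wf b
  end.

Lemma size_compile off c : size (compile off c) = csize c.
Proof.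
elim: c off => [|o|a IHa b IHb|c a IHa b IHb|c b IHb] off //=.
- by rewrite size_cat IHa IHb.
- by case: c => [x y|x]; rewrite !size_cat /= IHa IHb /=; lia.
- by case: c => [x y|x]; rewrite !size_cat /= size_cat IHb /=; lia.
Qed.

Definition code_at (prog : program) (off : nat) (code : seq instr) : Prop :=
  exists pre post, prog = pre ++ code ++ post /\ size pre = off.

Lemma code_at_catl prog off s1 s2 :
  code_at prog off (s1 ++ s2) -> code_at prog off s1.
Proof. by move=> [pre [post [-> <-]]]; exists pre, (s2 ++ post); rewrite -!catA. Qed.

Lemma code_at_catr prog off s1 s2 :
  code_at prog off (s1 ++ s2) -> code_at prog (off + size s1) s2.
Proof.
move=> [pre [post [-> <-]]]; exists (pre ++ s1), post.
by rewrite size_cat -!catA.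
Qed.

Lemma code_at_nth prog off code i :
  code_at prog off code -> i < size code ->
  off + i < size prog /\ nth (IJump 0) prog (off + i) = nth (IJump 0) code i.
Proof.
move=> [pre [post [-> <-]]] ilt; split; first by rewrite !size_cat; lia.
by rewrite nth_cat ltnNge leq_addr /= addKn nth_cat ilt.
Qed.

Lemma stepsD w S prog t1 t2 st :
  steps w S prog (t1 + t2) st = obind (steps w S prog t2) (steps w S prog t1 st).
Proof.
elim: t1 st => //= t1 IH st.
by case: (step w S prog st) => [st'|] //=.
Qed.

Local Arguments steps : simpl never.

Lemma step_code w S prog off code i R M st' :
  code_at prog off code -> i < size code ->
  exec_instr w S (nth (IJump 0) code i) (State (off + i) R M) = Some st' ->
  steps w S prog 1 (State (off + i) R M) = Some st'.
Proof.
move=> h ilt; have [h1 h2] := code_at_nth h ilt.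
by rewrite /steps /step /halted /= leqNgt h1 /= h2 => ->.
Qed.

Section Triples.

Variables w S : nat.

(* Excludes wrap-around modulo [2 ^ w] and memory faults. *)
Definition op_pre (o : op) (R : nat -> nat) : Prop :=
  match o with
  | OSet d v => v < 2 ^ w
  | OMov d a => True
  | OAdd d a b => R a + R b < 2 ^ w
  | OAddI d a k => R a + k < 2 ^ w
  | OMulI d a k => k < 2 ^ w /\ R a * k < 2 ^ w
  | OSub d a b => R b <= R a < 2 ^ w
  | OLd d a k => R a + k < S
  | OSt a k s => R a + k < S
  end.

Definition op_regs (o : op) (R M : nat -> nat) : nat -> nat :=
  match o with
  | OSet d v => upd R d v
  | OMov d a => upd R d (R a)
  | OAdd d a b => upd R d (R a + R b)
  | OAddI d a k => upd (upd R tmp k) d (R a + k)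
  | OMulI d a k => upd (upd R tmp k) d (R a * k)
  | OSub d a b => upd R d (R a - R b)
  | OLd d a k => upd (upd (upd R tmp k) tmp (R a + k)) d (M (R a + k))
  | OSt a k s => upd (upd R tmp k) tmp (R a + k)
  end.

Definition op_mem (o : op) (R M : nat -> nat) : nat -> nat :=
  if o is OSt a k s then upd M (R a + k) (R s) else M.

Definition cond_eval (c : cond) (R : nat -> nat) : bool :=
  match c with CLt a b => R a < R b | CZ a => R a == 0 end.

Definition cond_regs (c : cond) (R : nat -> nat) : nat -> nat :=
  if c is CZ _ then upd R tmp 0 else R.

Definition okT (c : cmd) (T : nat) (Q : (nat -> nat) -> (nat -> nat) -> Prop)
    (R M : nat -> nat) : Prop :=
  forall prog off, wf c -> code_at prog off (compile off c) ->
  exists t R' M', [/\ t <= T,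
    steps w S prog t (State off R M) = Some (State (off + csize c) R' M')
    & Q R' M'].

Notation ok c Q R M := (okT c (csize c) Q R M).

Lemma ok_skip (Q : (nat -> nat) -> (nat -> nat) -> Prop) R M :
  Q R M -> ok Skip Q R M.
Proof. by move=> h prog off _ _; exists 0, R, M; rewrite addn0; split. Qed.

Lemma ok_weak c T T' (Q Q' : (nat -> nat) -> (nat -> nat) -> Prop) R M :
  T <= T' -> (forall R' M', Q R' M' -> Q' R' M') ->
  okT c T Q R M -> okT c T' Q' R M.
Proof.
move=> leT QQ h prog off hw hc.
have [t [R' [M' [h1 h2 h3]]]] := h prog off hw hc.
by exists t, R', M'; split; [exact: leq_trans leT | | exact: QQ].
Qed.

Lemma okT_seq a b T1 T2 Q R M :
  okT a T1 (okT b T2 Q) R M -> okT (Seq a b) (T1 + T2) Q R M.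
Proof.
move=> h prog off /= /andP [wa wb] hc.
have [t1 [R1 [M1 [h1 h2 h3]]]] := h prog off wa (code_at_catl hc).
have hc' := code_at_catr hc; rewrite size_compile in hc'.
have [t2 [R2 [M2 [h4 h5 h6]]]] := h3 prog _ wb hc'.
exists (t1 + t2), R2, M2; split=> //; first lia.
by rewrite stepsD h2 /= h5 addnA.
Qed.

Lemma ok_seq a b (P Q : (nat -> nat) -> (nat -> nat) -> Prop) R M :
  ok a P R M -> (forall R' M', P R' M' -> ok b Q R' M') ->
  ok (Seq a b) Q R M.
Proof. by move=> h1 h2; apply: okT_seq; apply: ok_weak h1. Qed.

Lemma cond_steps c l prog off R M :
  cond_wf c -> code_at prog off (cond_code c l) ->
  steps w S prog (cond_size c) (State off R M) =
    Some (State (if cond_eval c R then l else off + cond_size c) (cond_regs c R) M).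
Proof.
case: c => [a b|a] /= hw hc.
- rewrite -[X in State X R M]addn0.
  rewrite (step_code (st' := goto_if (R a < R b) l (State (off + 0) R M)) hc) //.
  by rewrite /goto_if /= addn0 addn1.
- have e0 : steps w S prog 1 (State (off + 0) R M) = Some (State (off + 1) (upd R tmp 0) M).
    by apply: (step_code hc) => //=; rewrite /set_reg /= mod0n addn0 addn1.
  have e1 : steps w S prog 1 (State (off + 1) (upd R tmp 0) M) =
      Some (goto_if (R a == 0) l (State (off + 1) (upd R tmp 0) M)).
    by apply: (step_code hc) => //=; rewrite upd_same upd_diff.
  rewrite -[X in State X R M]addn0 (stepsD _ _ _ 1 1) e0 [obind _ _]e1.
  by rewrite /goto_if /=; case: ifP => //; rewrite addn1 addn2.
Qed.

Lemma jump_steps l prog off R M :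
  code_at prog off [:: IJump l] ->
  steps w S prog 1 (State off R M) = Some (State l R M).
Proof. by move=> hc; rewrite -[off]addn0; apply: (step_code hc). Qed.

Lemma size_cond_code c l : size (cond_code c l) = cond_size c.
Proof. by case: c. Qed.

Lemma ok_if c a b (Q : (nat -> nat) -> (nat -> nat) -> Prop) R M :
  (cond_eval c R -> ok a Q (cond_regs c R) M) ->
  (~~ cond_eval c R -> ok b Q (cond_regs c R) M) ->
  ok (If c a b) Q R M.
Proof.
move=> ha hb prog off /= /and3P [wc wa wb] hc.
have h1 := cond_steps R M wc (code_at_catl hc).
have hc1 := code_at_catr hc; rewrite size_cond_code in hc1.
have hb1 := code_at_catl hc1.
have hc2 := code_at_catr hc1; rewrite size_compile -cat1s in hc2.
have hj := jump_steps _ _ (code_at_catl hc2).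
have ha1 := code_at_catr hc2; rewrite /= in ha1.
case: (boolP (cond_eval c R)) => hcr; rewrite ?hcr ?(negbTE hcr) in h1.
- have [t [R' [M' [t1 t2 t3]]]] := ha hcr prog _ wa ha1.
  exists (cond_size c + t), R', M'; split=> //=; first lia.
  by rewrite stepsD h1 /= t2; congr (Some (State _ _ _)); lia.
- have [t [R' [M' [t1 t2 t3]]]] := hb hcr prog _ wb hb1.
  exists (cond_size c + (t + 1)), R', M'; split=> //=; first lia.
  rewrite stepsD h1 [obind _ _]stepsD t2.
  by rewrite [obind _ _](hj R' M'); congr (Some (State _ _ _)); lia.
Qed.

Lemma okT_while c b (I : nat -> (nat -> nat) -> (nat -> nat) -> Prop) k R M :
  (forall k R M, I k R M -> cond_eval c R ->
     ok b (fun R' M' => exists2 k', k' < k & I k' R' M') (cond_regs c R) M) ->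
  I k R M ->
  okT (While c b) (k.+1 * csize (While c b))
    (fun R' M' => exists k' R0,
       [/\ I k' R0 M', ~~ cond_eval c R0 & R' = cond_regs c R0]) R M.
Proof.
move=> hb; elim/ltn_ind: k R M => k IH R M hI prog off /= /andP [wc wb] hc.
have h1 := cond_steps R M wc (code_at_catl hc).
have hc1 := code_at_catr hc; rewrite size_cond_code -cat1s in hc1.
have hj := jump_steps _ _ (code_at_catl hc1).
have hc2 := code_at_catr hc1; rewrite /= in hc2.
have hb1 := code_at_catl hc2.
have hc3 := code_at_catr hc2; rewrite size_compile in hc3.
case: (boolP (cond_eval c R)) => hcr; rewrite ?hcr ?(negbTE hcr) in h1.
- have [t [R1 [M1 [t1 t2 [k' lk hI']]]]] := hb _ _ _ hI hcr prog _ wb hb1.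
  have ww : wf (While c b) by rewrite /= wc.
  have [t' [R' [M' [u1 u2 u3]]]] := IH k' lk R1 M1 hI' prog off ww hc.
  have hj2 := jump_steps R1 M1 hc3.
  exists (cond_size c + (t + (1 + t'))), R', M'; split=> //=.
    by move: u1; rewrite /=; nia.
  by rewrite stepsD h1 [obind _ _]stepsD t2 [obind _ _]stepsD hj2 [obind _ _]u2.
- exists (cond_size c + 1), (cond_regs c R), M; split=> //=; first lia.
    rewrite stepsD h1 [obind _ _](hj (cond_regs c R) M).
    by congr (Some (State _ _ _)); lia.
  by exists k, R.
Qed.

Hypothesis S_le : S <= 2 ^ w.

Lemma ok_op1 o (Q : (nat -> nat) -> (nat -> nat) -> Prop) R M :
  op_pre o R -> Q (op_regs o R M) (op_mem o R M) -> ok (Op o) Q R M.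
Proof.
move=> hp hQ prog off /= hw hc; exists (size (op_code o)), (op_regs o R M), (op_mem o R M).
split=> //.
have ex i T T' : i < size (op_code o) ->
  exec_instr w S (nth (IJump 0) (op_code o) i) (State (off + i) T.1 T.2) =
    Some (State (off + i).+1 T'.1 T'.2) ->
  steps w S prog 1 (State (off + i) T.1 T.2) = Some (State (off + i.+1) T'.1 T'.2).
  by move=> ilt e; rewrite (step_code hc ilt e) addnS.
case: o hp hQ hw hc ex => /= [d v|d a|d a b|d a k|d a k|d a b|d a k|a k s] hp _ hw _ ex.
- rewrite -[X in State X R M]addn0.
  by apply: (ex 0 (R, M) (_, _)) => //; rewrite /set_reg /= modn_small.
- by rewrite -[X in State X R M]addn0; apply: (ex 0 (R, M) (_, _)).
- rewrite -[X in State X R M]addn0; apply: (ex 0 (R, M) (_, _)) => //.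
  by rewrite /= /set_reg /eval_binop modn_small.
- rewrite -[X in State X R M]addn0 (stepsD _ _ _ 1 1).
  rewrite (ex 0 (R, M) (upd R tmp k, M)) //; last first.
    by rewrite /set_reg /= modn_small //; lia.
  apply: (ex 1 (_, _) (_, _)) => //.
  by rewrite /= /set_reg /eval_binop /= upd_same (upd_diff _ _ hw) modn_small.
- case: hp => hk hp; rewrite -[X in State X R M]addn0 (stepsD _ _ _ 1 1).
  rewrite (ex 0 (R, M) (upd R tmp k, M)) //; last first.
    by rewrite /set_reg /= modn_small //; lia.
  apply: (ex 1 (_, _) (_, _)) => //.
  by rewrite /= /set_reg /eval_binop /= upd_same (upd_diff _ _ hw) modn_small.
- rewrite -[X in State X R M]addn0; apply: (ex 0 (R, M) (_, _)) => //.
  have [h1 h2] := andP hp.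
  rewrite /= /set_reg /eval_binop /=; congr (Some (State _ (upd _ _ _) _)).
  have -> : R a + 2 ^ w - R b = (R a - R b) + 2 ^ w by lia.
  by rewrite modnDr modn_small //; lia.
- rewrite -[X in State X R M]addn0 (stepsD _ _ _ 2 1) (stepsD _ _ _ 1 1).
  have hS : R a + k < 2 ^ w by lia.
  rewrite (ex 0 (R, M) (upd R tmp k, M)) //; last first.
    by rewrite /set_reg /= modn_small //; lia.
  rewrite [obind _ (Some _)](ex 1 (upd R tmp k, M) (upd (upd R tmp k) tmp (R a + k), M)) //.
    apply: (ex 2 (_, _) (_, _)) => //.
    by rewrite /set_reg /= upd_same hp.
  by rewrite /= /set_reg /eval_binop /= upd_same (upd_diff _ _ hw) modn_small.
- rewrite -[X in State X R M]addn0 (stepsD _ _ _ 2 1) (stepsD _ _ _ 1 1).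
  have hS : R a + k < 2 ^ w by lia.
  have [ha hs] := andP hw.
  rewrite (ex 0 (R, M) (upd R tmp k, M)) //; last first.
    by rewrite /set_reg /= modn_small //; lia.
  rewrite [obind _ (Some _)](ex 1 (upd R tmp k, M) (upd (upd R tmp k) tmp (R a + k), M)) //.
    apply: (ex 2 (_, _) (_, _)) => //.
    by rewrite /set_reg /= upd_same hp !upd_diff.
  by rewrite /= /set_reg /eval_binop /= upd_same (upd_diff _ _ ha) modn_small.
Qed.

Lemma ok_op o b Q R M :
  op_pre o R -> ok b Q (op_regs o R M) (op_mem o R M) ->
  ok (Seq (Op o) b) Q R M.
Proof. by move=> h1 h2; apply: okT_seq; apply: ok_op1. Qed.

End Triples.

(** * Breakpoints and crowded intervals *)

(* [pi] extended by [n |-> n], so that the sentinel is an ordinary breakpoint. *)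
Definition hat n (pi : 'S_n) (x : nat) : nat := if x < n then papply pi x else x.

Lemma papplyE n (pi : 'S_n) x (h : x < n) : papply pi x = pi (Ordinal h).
Proof. by rewrite /papply insubT. Qed.

Lemma hat_lt n (pi : 'S_n) x : (hat pi x < n) = (x < n).
Proof. by rewrite /hat; case: ifP => // h; rewrite (papplyE pi h) ltn_ord. Qed.

Lemma hatK n (pi : 'S_n) x : hat pi^-1 (hat pi x) = x.
Proof.
rewrite {1}/hat hat_lt; case: (ltnP x n) => h; last by rewrite /hat ltnNge h.
have e : hat pi x = pi (Ordinal h) by rewrite /hat h (papplyE pi h).
have h' : hat pi x < n by rewrite hat_lt.
rewrite (papplyE _ h') [Ordinal h'](_ : _ = pi (Ordinal h)) ?permK //.
exact: val_inj.
Qed.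

Lemma hatVK n (pi : 'S_n) x : hat pi (hat pi^-1 x) = x.
Proof. by rewrite -{1}[pi]invgK hatK. Qed.

Lemma hat_inj n (pi : 'S_n) : injective (hat pi).
Proof. exact: can_inj (hatK pi). Qed.

Lemma hat_le n (pi : 'S_n) x : (hat pi x <= n) = (x <= n).
Proof.
rewrite /hat; case: ifP => // h.
by have := hat_lt pi x; rewrite /hat h => h'; lia.
Qed.

Lemma hat_n n (pi : 'S_n) : hat pi n = n.
Proof. by rewrite /hat ltnn. Qed.

Definition is_next (N : pred nat) (x y : nat) : Prop :=
  [/\ x < y, N y & forall z, x < z < y -> ~~ N z].

Lemma is_next_fun N x y y' : is_next N x y -> is_next N x y' -> y = y'.
Proof.
move=> [h1 h2 h3] [h4 h5 h6]; case: (ltngtP y y') => // h.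
- by have := h6 y; rewrite h1 h h2 => /(_ isT).
- by have := h3 y'; rewrite h4 h h5 => /(_ isT).
Qed.

Lemma is_next_inj (N : pred nat) x x' y :
  N x -> N x' -> is_next N x y -> is_next N x' y -> x = x'.
Proof.
move=> hx hx' [h1 h2 h3] [h4 h5 h6]; case: (ltngtP x x') => // h.
- by have := h3 x'; rewrite h4 h hx' => /(_ isT).
- by have := h6 x; rewrite h1 h hx => /(_ isT).
Qed.

Definition nextp (N : pred nat) (n x : nat) : nat :=
  x.+1 + find N (iota x.+1 (n - x)).

Lemma nextpP (N : pred nat) n x :
  x < n -> N n -> is_next N x (nextp N n x) /\ nextp N n x <= n.
Proof.
move=> hx hn.
have hh : has N (iota x.+1 (n - x)).
  by apply/hasP; exists n => //; rewrite mem_iota; lia.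
have hlt := hh; rewrite has_find size_iota in hlt.
split; last by rewrite /nextp; lia.
split; first by rewrite /nextp; lia.
- by have := nth_find 0 hh; rewrite nth_iota.
move=> z /andP [h1 h2].
have hz : z - x.+1 < find N (iota x.+1 (n - x)) by move: h2; rewrite /nextp; lia.
have := before_find 0 hz; rewrite nth_iota; last by lia.
by rewrite subnKC // => ->.
Qed.

Lemma prev_exists (N : pred nat) x : 0 < x -> N 0 -> N x ->
  exists2 y, N y & is_next N y x.
Proof.
move=> hx h0 Nx.
have ex : exists y, (y < x) && N y by exists 0; rewrite hx.
have ub y : (y < x) && N y -> y <= x by case/andP => /ltnW.
case: (ex_maxnP ex ub) => y /andP [h1 h2] h3.
exists y => //; split=> // z /andP [h4 h5]; apply/negP => Nz.
by have := h3 z; rewrite h5 Nz => /(_ isT); lia.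
Qed.

Section Breakpoints.

Variables (n : nat) (pi : 'S_n).
Implicit Types A N : pred nat.

Definition outs A : pred nat := fun x => A (hat pi^-1 x).
Definition nodes A : pred nat := fun x => A x || outs A x.

Record breakpoints A : Prop := Breakpoints {
  bp_n : A n;
  bp_le : forall x, A x -> x <= n;
  bp_starts : forall x, x < n -> starts_interval pi x -> A x }.

Definition gap A a o : Prop := forall y, a < y <= a + o -> ~~ A y.

(* Offsets, inside the input interval starting at [a] and its image, at which
   one of the two contains a node. *)
Definition offset A a o : Prop :=
  [/\ 0 < o, gap A a o & nodes A (a + o) || nodes A (hat pi a + o)].

Definition crowded A a : Prop := exists o1 o2 o3,
  [/\ offset A a o1, offset A a o2, offset A a o3, o1 < o2 & o2 < o3].

Lemma outs_hat A x : outs A (hat pi x) = A x.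
Proof. by rewrite /outs hatK. Qed.

Lemma nodes_le A x : breakpoints A -> nodes A x -> x <= n.
Proof.
move=> hA /orP [/(bp_le hA) //|/(bp_le hA)]; by rewrite hat_le.
Qed.

Lemma bp_0 A : breakpoints A -> 0 < n -> A 0.
Proof. by move=> hA h; apply: (bp_starts hA). Qed.

Lemma outs_n A : breakpoints A -> outs A n.
Proof. by move=> /bp_n h; rewrite /outs hat_n. Qed.

Lemma not_starts x : ~~ starts_interval pi x ->
  0 < x /\ papply pi x = (papply pi x.-1).+1.
Proof.
rewrite /starts_interval negb_or negbK => /andP [h1 /eqP <-].
by rewrite lt0n.
Qed.

Lemma outs_0 A : breakpoints A -> 0 < n -> outs A 0.
Proof.
move=> hA hn; rewrite /outs; set y := hat _ _.
have hy : y < n by rewrite hat_lt.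
case: (boolP (A y)) => // nA.
have/not_starts [h1 h2] : ~~ starts_interval pi y.
  by apply: contra nA; apply: (bp_starts hA).
have := hatVK pi 0; rewrite -/y /hat hy h2; lia.
Qed.

Lemma gap_lt A a o : breakpoints A -> a < n -> gap A a o -> a + o < n.
Proof.
move=> hA ha g; rewrite ltnNge; apply/negP => h.
by have := g n; rewrite ha h (bp_n hA) => /(_ isT).
Qed.

Lemma gap_mono A a o o' : o' <= o -> gap A a o -> gap A a o'.
Proof. by move=> le g y h; apply: g; lia. Qed.

Lemma contiguous A a o : breakpoints A -> a < n -> gap A a o ->
  hat pi (a + o) = hat pi a + o.
Proof.
move=> hA ha; elim: o => [|o IH] g; first by rewrite !addn0.
have g' : gap A a o by apply: gap_mono g.
have lt := gap_lt hA ha g.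
have nA : ~~ A (a + o.+1) by apply: g; lia.
have/not_starts [h1 h2] : ~~ starts_interval pi (a + o.+1).
  by apply: contra nA; apply: (bp_starts hA).
rewrite /hat lt h2 addnS /=; have := IH g'.
by rewrite /hat (_ : a + o < n); [move->; rewrite addnS | lia].
Qed.

Lemma outs_end A a o : breakpoints A -> a < n -> gap A a o ->
  A (a + o.+1) -> outs A (hat pi a + o.+1).
Proof.
move=> hA ha g hAo.
have lt := gap_lt hA ha g.
have e := contiguous hA ha g.
have lt2 : hat pi a + o < n by rewrite -e hat_lt.
have [eq|h] : hat pi a + o.+1 = n \/ hat pi a + o.+1 < n by lia.
  by rewrite eq (outs_n hA).
rewrite /outs; set y := hat _ (_ + _).
have hy : y < n by rewrite hat_lt.
case: (boolP (A y)) => // nA.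
have/not_starts [h1 h2] : ~~ starts_interval pi y.
  by apply: contra nA; apply: (bp_starts hA).
have e2 : hat pi y = hat pi a + o.+1 by rewrite hatVK.
have e3 : hat pi y.-1 = hat pi (a + o).
  have -> : hat pi y.-1 = papply pi y.-1 by rewrite /hat ifT //; lia.
  by move: e2; rewrite e {1}/hat hy h2; lia.
have e4 := hat_inj e3.
by rewrite (_ : a + o.+1 = y) in hAo; [rewrite hAo in nA | lia].
Qed.

Lemma gap_outs A a o : breakpoints A -> a < n ->
  gap A a o <-> gap (outs A) (hat pi a) o.
Proof.
move=> hA ha; split=> [g y hy|].
  have g' : gap A a (y - hat pi a) by apply: gap_mono g; lia.
  have -> : y = hat pi (a + (y - hat pi a)) by rewrite (contiguous hA) //; lia.
  by rewrite outs_hat; apply: g; lia.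
elim: o => [|o IH] g; first by move=> y; lia.
have g' : gap A a o by apply: IH; apply: gap_mono g.
move=> y hy; have [le|eq] : y <= a + o \/ y = a + o.+1 by lia.
  by apply: g'; lia.
apply/negP; rewrite eq => h; have := outs_end hA ha g' h.
by apply/negP; apply: g; lia.
Qed.

Definition well_charged A : Prop := forall c,
  A c -> c < n -> ~~ starts_interval pi c -> exists o, offset A c o.

Lemma count_outs A : count (outs A) (iota 0 n.+1) = count A (iota 0 n.+1).
Proof.
rewrite -[LHS](count_map (hat pi^-1) A).
have /seq.permP -> // : perm_eq [seq hat pi^-1 i | i <- iota 0 n.+1] (iota 0 n.+1).
apply: uniq_perm.
- by rewrite map_inj_uniq ?iota_uniq //; exact: hat_inj.
- exact: iota_uniq.
move=> x; rewrite mem_iota add0n ltnS; apply/mapP/idP.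
  by move=> [y]; rewrite mem_iota => hy ->; rewrite hat_le; lia.
by move=> hx; exists (hat pi x); rewrite ?hatK // mem_iota add0n /= ltnS hat_le.
Qed.

Lemma count_compl (A N : pred nat) s :
  (forall x, A x -> N x) -> count (fun x => N x && ~~ A x) s = count N s - count A s.
Proof.
move=> sub; elim: s => //= x s ->.
have : count A s <= count N s by apply: sub_count.
by have := sub x; case: (A x); case: (N x) => //= h; try (by have := h isT); lia.
Qed.

Lemma count_add1 N y : ~~ N y -> y <= n ->
  count (fun x => N x || (x == y)) (iota 0 n.+1) = (count N (iota 0 n.+1)).+1.
Proof.
move=> Ny yn.
have e : predI N (pred1 y) =1 pred0.
  by move=> x /=; case: eqP => [->|]; rewrite ?andbF // (negbTE Ny).
have := count_predUI N (pred1 y) (iota 0 n.+1).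
rewrite (eq_count e) count_pred0 addn0 (count_uniq_mem _ (iota_uniq _ _)).
by rewrite mem_iota add0n ltnS yn addn1 => <-.
Qed.

(* A charged breakpoint is sent to the first node after it, or after its
   image, whichever lies inside the interval. *)
Lemma count_breakpoints A : breakpoints A -> well_charged A ->
  count (nodes A) (iota 0 n.+1) <= count A (iota 0 n.+1) + nb_intervals pi ->
  count A (iota 0 n.+1) <= (3 * nb_intervals pi).+1.
Proof.
move=> hA hz hN; set s := iota 0 n.+1.
have Nn : nodes A n by rewrite /nodes (bp_n hA).
pose B0 x := (x == n) || starts_interval pi x.
pose B1 x := [&& A x, x < n & ~~ A (nextp (nodes A) n x)].
pose B2 x := [&& A x, x < n & ~~ outs A (nextp (nodes A) n (hat pi x))].
have sub : forall x, A x -> [|| B0 x, B1 x | B2 x].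
  move=> x Ax; rewrite /B0 /B1 /B2 Ax /=.
  case: (eqVneq x n) => //= ne; case: (boolP (starts_interval pi x)) => //= ns.
  have lt : x < n by have := bp_le hA Ax; lia.
  have lt2 : hat pi x < n by rewrite hat_lt.
  rewrite lt /=; have [o [o0 g h]] := hz x Ax lt ns.
  case/orP: h => h.
    have [[h1 h2 h3] h4] := nextpP lt Nn.
    apply/orP; left; apply: g; rewrite h1 /= leqNgt; apply/negP => h5.
    by have := h3 (x + o); rewrite h5 h => /(_ ltac:(lia)).
  have [[h1 h2 h3] h4] := nextpP lt2 Nn.
  apply/orP; right; move/(gap_outs _ hA lt): g => g.
  apply: g; rewrite h1 /= leqNgt; apply/negP => h5.
  by have := h3 (hat pi x + o); rewrite h5 h => /(_ ltac:(lia)).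
have le1 : count A s <= count B0 s + count B1 s + count B2 s.
  elim: s => //= x s IH; have := sub x.
  by case: (A x); case: (B0 x); case: (B1 x); case: (B2 x) => //= h;
    try (by have := h isT); lia.
have leB0 : count B0 s <= (nb_intervals pi).+1.
  rewrite /s -addn1 iotaD count_cat /= /nb_intervals /starts size_filter add0n.
  have -> : count B0 (iota 0 n) = count (starts_interval pi) (iota 0 n).
    apply: eq_in_count => x; rewrite mem_iota /B0 => hx.
    by rewrite (_ : x == n = false) //; lia.
  by case: (B0 n); rewrite ?addn0 ?addn1 //; exact: leqnSn.
have inj k : forall x y, x < n -> y < n -> nodes A x -> nodes A y ->
    k = nextp (nodes A) n x -> k = nextp (nodes A) n y -> x = y.
  move=> x y hx hy Nx Ny ex ey; apply: (is_next_inj (y := k) Nx Ny).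
  - by rewrite ex; exact: (nextpP hx Nn).1.
  - by rewrite ey; exact: (nextpP hy Nn).1.
have leB1 : count B1 s <= count (nodes A) s - count A s.
  rewrite -count_compl; last by move=> x; rewrite /nodes => ->.
  rewrite -!size_filter -(size_map (nextp (nodes A) n)).
  apply: uniq_leq_size.
    rewrite map_inj_in_uniq ?filter_uniq ?iota_uniq // => x y.
    rewrite !mem_filter => /andP [/and3P [Ax lx _] _] /andP [/and3P [Ay ly _] _] e.
    by apply: (inj _ x y lx ly _ _ erefl e); rewrite /nodes ?Ax ?Ay.
  move=> k /mapP [x]; rewrite mem_filter => /andP [/and3P [Ax lx nA] _] ->.
  have [[_ h2 _] h3] := nextpP lx Nn.
  by rewrite mem_filter h2 nA mem_iota; lia.
have leB2 : count B2 s <= count (nodes A) s - count A s.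
  rewrite -(count_outs A) -count_compl; last by move=> x; rewrite /nodes => ->; rewrite orbT.
  rewrite -!size_filter -(size_map (fun x => nextp (nodes A) n (hat pi x))).
  apply: uniq_leq_size.
    rewrite map_inj_in_uniq ?filter_uniq ?iota_uniq // => x y.
    rewrite !mem_filter => /andP [/and3P [Ax lx _] _] /andP [/and3P [Ay ly _] _] e.
    by apply: (@hat_inj _ pi); apply: (inj _ _ _ _ _ _ _ erefl e);
      rewrite /nodes ?hat_lt ?outs_hat ?Ax ?Ay ?orbT.
  move=> k /mapP [x]; rewrite mem_filter => /andP [/and3P [Ax lx nA] _] ->.
  rewrite -(hat_lt pi) in lx.
  have [[_ h2 _] h3] := nextpP lx Nn.
  by rewrite mem_filter h2 nA mem_iota; lia.
rewrite -/s in hN; move: le1 leB0 leB1 leB2 hN.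
move: (count B0 s) (count B1 s) (count B2 s) (count A s) (count (nodes A) s).
by move=> b0 b1 b2 cA cN; lia.
Qed.

Section Cut.

Variables (A : pred nat) (a o1 o2 o3 : nat).
Hypotheses (hA : breakpoints A) (Aa : A a) (an : a < n).
Hypotheses (D1 : offset A a o1) (D2 : offset A a o2) (D3 : offset A a o3).
Hypotheses (lt12 : o1 < o2) (lt23 : o2 < o3).
Hypothesis second : forall o, offset A a o -> o < o2 -> o = o1.

Definition cut : pred nat := fun x => A x || (x == a + o2).

Lemma cut_lt : a + o2 < n.
Proof. by case: D2 => _ g _; apply: gap_lt g. Qed.

Lemma hat_cut : hat pi (a + o2) = hat pi a + o2.
Proof. by case: D2 => _ g _; apply: contiguous g. Qed.

Lemma cut_fresh : ~~ A (a + o2).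
Proof. by case: D2 => h g _; apply: g; lia. Qed.

Lemma breakpoints_cut : breakpoints cut.
Proof.
split; rewrite /cut.
- by rewrite (bp_n hA).
- by move=> x /orP [/(bp_le hA) //|/eqP ->]; apply: ltnW cut_lt.
- by move=> x h1 h2; rewrite (bp_starts hA).
Qed.

Lemma outs_cut x : outs cut x = outs A x || (x == hat pi a + o2).
Proof.
rewrite /outs /cut -hat_cut; congr (_ || _).
by apply/eqP/eqP => [<-|->]; rewrite ?hatVK ?hatK.
Qed.

Lemma nodes_cut x :
  nodes cut x = [|| nodes A x, x == a + o2 | x == hat pi a + o2].
Proof.
rewrite /nodes outs_cut /cut; case: (A x); case: (outs A x) => //=.
by case: (x == a + o2).
Qed.

Lemma gap_cut c o : gap cut c o -> gap A c o.
Proof. by move=> g y /g; rewrite /cut negb_or => /andP []. Qed.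

Lemma well_charged_cut : well_charged A -> well_charged cut.
Proof.
have [p1 g1 _] := D1; have [p2 g2 _] := D2; have [p3 g3 _] := D3.
have Nsub x : nodes A x -> nodes cut x by rewrite nodes_cut => ->.
have Nsub2 x y : nodes A x || nodes A y -> nodes cut x || nodes cut y.
  by case/orP => /Nsub ->; rewrite ?orbT.
move=> hz c Ac lc ns.
case: (eqVneq c a) => [->|ca].
  exists o1; split=> //; last by apply: Nsub2; case: D1.
  by move=> y hy; rewrite /cut negb_or g1 //=; lia.
case: (eqVneq c (a + o2)) => [->|cp].
  exists (o3 - o2); split; first lia.
    by move=> y hy; rewrite /cut negb_or g3 //=; lia.
  rewrite hat_cut; apply: Nsub2.
  by rewrite -!addnA !subnKC ?(ltnW lt23) //; case: D3.
rewrite /cut (negbTE cp) orbF in Ac.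
have [o [p g h]] := hz c Ac lc ns; exists o; split=> //; last exact: Nsub2.
clear h.
move=> y hy; rewrite /cut negb_or g //=; apply/eqP => ye.
have [h1|h1] : c < a \/ a < c by lia.
  by have := g a; rewrite Aa => /(_ ltac:(lia)).
by have := g2 c; rewrite Ac => /(_ ltac:(lia)).
Qed.

Lemma count_cut : count cut (iota 0 n.+1) = (count A (iota 0 n.+1)).+1.
Proof. exact: (count_add1 cut_fresh (ltnW cut_lt)). Qed.

Lemma cut_old : nodes A (a + o2) || nodes A (hat pi a + o2).
Proof. by case: D2. Qed.

Lemma offset_lt_n c o : breakpoints cut -> cut c -> offset cut c o -> c < n.
Proof.
move=> hc /(bp_le hc) le [p g h]; rewrite ltn_neqAle le andbT; apply/eqP => e.
rewrite e in h g p; rewrite hat_n orbb in h.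
have := nodes_le hc h; lia.
Qed.

Lemma offset_cut c o : cut c -> offset cut c o ->
  offset A c o \/ (~~ nodes A (a + o2) /\ hat pi c + o = a + o2)
               \/ (~~ nodes A (hat pi a + o2) /\ c + o = hat pi a + o2).
Proof.
move=> Ac D; have cn := offset_lt_n breakpoints_cut Ac D.
case: D => p g h.
have gA := gap_cut g.
have Dif : nodes A (c + o) || nodes A (hat pi c + o) -> offset A c o by split.
move: h; rewrite !nodes_cut => /orP [/or3P [h|/eqP h|/eqP h]|/or3P [h|/eqP h|/eqP h]].
- by left; apply: Dif; rewrite h.
- by have := g (c + o); rewrite /cut h eqxx orbT => /(_ ltac:(lia)).
- case: (boolP (nodes A (hat pi a + o2))) => h'; last by right; right.
  by left; apply: Dif; rewrite h h'.
- by left; apply: Dif; rewrite h orbT.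
- case: (boolP (nodes A (a + o2))) => h'; last by right; left.
  by left; apply: Dif; rewrite h h' orbT.
- have := proj1 (gap_outs o breakpoints_cut cn) g (hat pi c + o).
  by rewrite outs_cut h eqxx orbT => /(_ ltac:(lia)).
Qed.

Lemma crowded_cut c : cut c -> crowded cut c ->
  c = a + o2 \/ [/\ c != a, A c
    & [\/ crowded A c,
          ~~ nodes A (a + o2) /\ (exists2 o, offset cut c o & hat pi c + o = a + o2)
        | ~~ nodes A (hat pi a + o2) /\
          (exists2 o, offset cut c o & c + o = hat pi a + o2)]].
Proof.
move=> Ac [e1 [e2 [e3 [E1 E2 E3 l12 l23]]]].
case: (eqVneq c (a + o2)) => [|cp]; [by left | right].
have Ac' : A c by move: Ac; rewrite /cut (negbTE cp) orbF.
case: (eqVneq c a) => [ca|ca].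
  exfalso; have key o : offset cut a o ->
      o = o1 \/ (~~ nodes A (a + o2) /\ hat pi a + o = a + o2)
             \/ (~~ nodes A (hat pi a + o2) /\ a + o = hat pi a + o2).
    move=> D; have [D'|] := offset_cut (o := o) (c := a) (eq_ind c cut Ac _ ca) D; last by right.
    left; apply: second => //; rewrite ltnNge; apply/negP => le.
    case: D => p g _; have := g (a + o2); rewrite /cut eqxx orbT.
    by case: D2 => q _ _ /(_ ltac:(lia)).
  rewrite ca in E1 E2 E3; have := cut_old.
  by have := key _ E1; have := key _ E2; have := key _ E3;
    case: (nodes A (a + o2)) => /=; case: (nodes A (hat pi a + o2)) => //= k1 k2 k3 _; lia.
split=> //.
have := offset_cut Ac E1; have := offset_cut Ac E2; have := offset_cut Ac E3.
move=> [F3|[[h e]|[h e]]]; last 2 first.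
- by constructor 2; split=> //; exists e3.
- by constructor 3; split=> //; exists e3.
move=> [F2|[[h e]|[h e]]]; last 2 first.
- by constructor 2; split=> //; exists e2.
- by constructor 3; split=> //; exists e2.
move=> [F1|[[h e]|[h e]]]; last 2 first.
- by constructor 2; split=> //; exists e1.
- by constructor 3; split=> //; exists e1.
by constructor 1; exists e1, e2, e3.
Qed.

Lemma crowded_cut_out c o : cut c -> ~ crowded A c ->
  ~~ nodes A (a + o2) -> offset cut c o -> hat pi c + o = a + o2 ->
  [/\ hat pi c < a + o2, forall z, hat pi c < z <= a + o2 -> ~~ outs cut z
    & forall z1 z2 z3, hat pi c < z1 -> z1 < z2 -> z2 < z3 -> z3 < a + o2 ->
        nodes cut z1 -> nodes cut z2 -> nodes cut z3 -> False].
Proof.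
move=> Ac ncr np Do eo; have cn := offset_lt_n breakpoints_cut Ac Do.
have [po go _] := Do; have old := cut_old.
have gQ := proj1 (gap_outs o breakpoints_cut cn) go.
have off z : hat pi c < z -> z < a + o2 -> nodes cut z -> offset A c (z - hat pi c).
  move=> z1 z2 Nz; have Dz : offset cut c (z - hat pi c).
    split; [by clear -z1; lia | by apply: gap_mono go; clear -z1 z2 eo; lia |].
    by apply/orP; right; rewrite subnKC // ltnW.
  have [//|[[_ h]|[h _]]] := offset_cut Ac Dz; first by clear -h z1 z2; lia.
  by move: old; rewrite (negbTE np) (negbTE h).
split; first by clear -po eo; lia.
  by move=> z hz; apply: gQ; clear -hz eo; lia.
move=> z1 z2 z3 h1 h2 h3 h4 N1 N2 N3; apply: ncr.
exists (z1 - hat pi c), (z2 - hat pi c), (z3 - hat pi c).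
split; [apply: off => // | apply: off => // | apply: off => // | |];
  by clear -h1 h2 h3 h4; lia.
Qed.

Lemma crowded_cut_in c o : cut c -> ~ crowded A c ->
  ~~ nodes A (hat pi a + o2) -> offset cut c o -> c + o = hat pi a + o2 ->
  [/\ c < hat pi a + o2, forall z, c < z <= hat pi a + o2 -> ~~ cut z
    & forall z1 z2 z3, c < z1 -> z1 < z2 -> z2 < z3 -> z3 < hat pi a + o2 ->
        nodes cut z1 -> nodes cut z2 -> nodes cut z3 -> False].
Proof.
move=> Ac ncr nx Do eo; have [po go _] := Do; have old := cut_old.
have off z : c < z -> z < hat pi a + o2 -> nodes cut z -> offset A c (z - c).
  move=> z1 z2 Nz; have Dz : offset cut c (z - c).
    split; [by clear -z1; lia | by apply: gap_mono go; clear -z1 z2 eo; lia |].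
    by apply/orP; left; rewrite subnKC // ltnW.
  have [//|[[h _]|[_ h]]] := offset_cut Ac Dz; last by clear -h z1 z2; lia.
  by move: old; rewrite (negbTE nx) (negbTE h).
split; first by clear -po eo; lia.
  by move=> z hz; apply: go; clear -hz eo; lia.
move=> z1 z2 z3 h1 h2 h3 h4 N1 N2 N3; apply: ncr.
exists (z1 - c), (z2 - c), (z3 - c).
split; [apply: off => // | apply: off => // | apply: off => // | |];
  by clear -h1 h2 h3 h4; lia.
Qed.

End Cut.

End Breakpoints.

Definition back_step (N Q : pred nat) y y' : Prop :=
  if Q y then y' = y else is_next N y' y.

Lemma back_step_to (N Q : pred nat) s p y1 y2 y3 :
  s < p -> N s -> Q s -> (forall y, s < y <= p -> ~~ Q y) ->
  (forall z1 z2 z3, s < z1 -> z1 < z2 -> z2 < z3 -> z3 < p ->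
     N z1 -> N z2 -> N z3 -> False) ->
  N y1 -> N y2 -> N y3 ->
  back_step N Q p y1 -> back_step N Q y1 y2 -> back_step N Q y2 y3 ->
  y3 = s.
Proof.
move=> sp Ns Qs nQ nz N1 N2 N3.
have one y y' : s <= y <= p -> back_step N Q y y' ->
    s <= y' <= p /\ (y' = s \/ (s < y' < y)).
  rewrite /back_step => hy; case: (boolP (Q y)) => Qy.
    have [e|e] : y = s \/ s < y by lia.
      by move=> ->; split; [lia | left].
    by have := nQ y; rewrite Qy => /(_ ltac:(lia)).
  move=> [h1 h2 h3]; have sy : s < y by have : y != s; [apply: contraNneq Qy => -> | lia].
  have : s <= y' by rewrite leqNgt; apply/negP => h; have := h3 s; rewrite Ns h sy => /(_ isT).
  by move=> h; split; lia.
have fix_s y : back_step N Q s y -> y = s by rewrite /back_step Qs.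
move=> b1 b2 b3.
have [r1 [e|q1]] := one p y1 ltac:(lia) b1.
  by rewrite e in b2; rewrite (fix_s _ b2) in b3; rewrite (fix_s _ b3).
have [r2 [e|q2]] := one _ _ r1 b2.
  by rewrite e in b3; rewrite (fix_s _ b3).
have [r3 [e|q3]] := one _ _ r2 b3; first by [].
by case: (nz y3 y2 y1) => //; lia.
Qed.

Section Elements.

Variable A : pred nat.

Definition elems (x : nat) : seq nat := [seq i <- iota 0 x | A i].
Definition rank_of (q : nat) : nat := (count A (iota 0 q.+1)).-1.

Lemma elems_sorted x : sorted ltn (elems x).
Proof. by apply: sorted_filter; [exact: ltn_trans | exact: iota_ltn_sorted]. Qed.

Lemma elems_uniq x : uniq (elems x).
Proof. by rewrite filter_uniq ?iota_uniq. Qed.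

Lemma mem_elems x y : (y \in elems x) = A y && (y < x).
Proof. by rewrite mem_filter mem_iota. Qed.

Lemma size_elems x : size (elems x) = count A (iota 0 x).
Proof. by rewrite size_filter. Qed.

Lemma elems_rcons x : elems x.+1 = if A x then rcons (elems x) x else elems x.
Proof.
rewrite /elems -addn1 iotaD filter_cat /= add0n; case: ifP => _; last by rewrite cats0.
by rewrite cats1.
Qed.

Lemma elems_catE x y : x <= y -> elems y = elems x ++ [seq i <- iota x (y - x) | A i].
Proof. by move=> h; rewrite /elems -{1}(subnKC h) iotaD filter_cat add0n. Qed.

Lemma elems_gap x y : x < y -> (forall z, x < z < y -> ~~ A z) -> elems y = elems x.+1.
Proof.
move=> xy g; rewrite (elems_catE xy) [X in _ ++ X](_ : _ = [::]) ?cats0 //.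
rewrite -(filter_pred0 (iota x.+1 (y - x.+1))).
by apply: eq_in_filter => z; rewrite mem_iota => hz; apply/negbTE/g; lia.
Qed.

Lemma nth_elems_mono x i j : i < j < size (elems x) -> nth 0 (elems x) i < nth 0 (elems x) j.
Proof.
move=> /andP [ij jl].
have := sorted_ltn_nth ltn_trans 0 (elems_sorted x).
by apply; rewrite ?inE //; apply: ltn_trans jl.
Qed.

End Elements.

Section Result.

Variables (n : nat) (pi : 'S_n) (A : pred nat).
Hypotheses (n0 : 0 < n) (hA : breakpoints pi A).
Hypothesis sparse : forall c, A c -> c < n -> ~ crowded pi A c.
Notation elems := (elems A).
Notation rank_of := (rank_of A).

Lemma rcons_elems : rcons (elems n) n = elems n.+1.
Proof. by rewrite elems_rcons (bp_n hA). Qed.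

Lemma is_rank_elems q : q < n -> is_rank (elems n) q (rank_of q).
Proof.
move=> qn.
have A0 := bp_0 hA n0.
have e : elems n = elems q.+1 ++ [seq i <- iota q.+1 (n - q.+1) | A i].
  by apply: elems_catE.
have sz : 0 < size (elems q.+1).
  have : 0 \in elems q.+1 by rewrite mem_elems A0.
  by case: (elems q.+1).
have lt : rank_of q < size (elems q.+1).
  by rewrite /rank_of -size_elems prednK.
split.
- by rewrite e size_cat; lia.
- have : nth 0 (elems n) (rank_of q) \in elems q.+1 by rewrite e nth_cat lt mem_nth.
  by rewrite mem_elems ltnS => /andP [].
move=> l hl hq.
have : nth 0 (elems n) l \in elems q.+1.
  have := mem_nth 0 hl; rewrite !mem_elems ltnS hq => /andP [-> _] //.
move=> hm.
have hi : index (nth 0 (elems n) l) (elems q.+1) < size (elems q.+1).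
  by rewrite index_mem.
have el : index (nth 0 (elems n) l) (elems q.+1) = l.
  rewrite -[RHS](index_uniq 0 hl (elems_uniq A n)) {3}e index_cat hm //.
have lr : l <= rank_of q by rewrite -el /rank_of -size_elems; lia.
case: (ltngtP l (rank_of q)) lr => // [llt|->] _ //.
apply: ltnW; apply: nth_elems_mono; rewrite llt e size_cat; lia.
Qed.

Lemma papply_hat x : x < n -> papply pi x = hat pi x.
Proof. by rewrite /hat => ->. Qed.

Lemma image_elems : image_of pi (elems n) = map (hat pi) (elems n).
Proof. by apply/eq_in_map => x; rewrite mem_elems => /andP [_ /papply_hat]. Qed.

Lemma bms_of alpha : 2 <= alpha -> count A (iota 0 n) <= 3 * nb_intervals pi ->
  balanced_move_structure alpha 3 pi (elems n) (image_of pi (elems n))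
    [seq rank_of (hat pi x) | x <- elems n].
Proof.
move=> ha hc.
have enth j : j < size (elems n) -> A (nth 0 (elems n) j) /\ nth 0 (elems n) j < n.
  by move=> h; have := mem_nth 0 h; rewrite mem_elems => /andP.
split.
- exact: elems_sorted.
- by move=> p; rewrite mem_elems => /andP [].
- move=> x; rewrite mem_filter mem_elems mem_iota => /and3P [hs _ xn].
  by rewrite (bp_starts hA).
- by rewrite size_elems.
- move=> j i hj; rewrite rcons_elems.
  have [Aj jn] := enth j hj.
  have ej : nth 0 (elems n.+1) j = nth 0 (elems n) j.
    by rewrite -rcons_elems nth_rcons hj.
  rewrite ej => /andP [h1 h2].
  have szS : size (elems n.+1) = (size (elems n)).+1 by rewrite -rcons_elems size_rcons.
  have g : gap A (nth 0 (elems n) j) (i - nth 0 (elems n) j).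
    move=> y hy; apply/negP => Ay; rewrite subnKC // in hy.
    have yn := bp_le hA Ay.
    have ym : y \in elems n.+1 by rewrite mem_elems Ay ltnS.
    have yi : index y (elems n.+1) < size (elems n.+1) by rewrite index_mem.
    have ny := nth_index 0 ym.
    case: (ltngtP (index y (elems n.+1)) j) => c.
    + have := @nth_elems_mono A n.+1 (index y (elems n.+1)) j.
      by rewrite ny ej c => /(_ ltac:(lia)); lia.
    + case: (ltngtP (index y (elems n.+1)) j.+1) => c'; first by lia.
        have := @nth_elems_mono A n.+1 j.+1 (index y (elems n.+1)).
        by rewrite ny c' yi => /(_ isT); lia.
      by move: h2; rewrite -c' ny; lia.
    + by move: ny; rewrite c ej; lia.
  have := contiguous hA jn g; rewrite subnKC // => e.
  have := gap_lt hA jn g; rewrite subnKC // => iltn.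
  by rewrite !papply_hat.
- by [].
- by rewrite size_map.
- move=> j hj; have [Aj jn] := enth j hj.
  rewrite (nth_map 0) // papply_hat //; apply: is_rank_elems.
  by rewrite hat_lt.
move=> k hk; rewrite image_elems; cbv zeta.
set s := sort leq _; set Q' := rcons s n.
have szs : size s = size (elems n) by rewrite size_sort size_map.
have ks : k < size s by rewrite szs.
have qk : nth 0 Q' k = nth 0 s k by rewrite nth_rcons ks.
have ms y : y \in s = (y < n) && outs pi A y.
  rewrite mem_sort; apply/mapP/andP.
    by move=> [x]; rewrite mem_elems => /andP [Ax xn] ->; rewrite hat_lt outs_hat.
  move=> [yn oy]; exists (hat pi^-1 y); last by rewrite hatVK.
  by rewrite mem_elems hat_lt yn andbT.
have ss : sorted leq s by apply: sort_sorted leq_total _.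
have mono i j : i <= j < size s -> nth 0 s i <= nth 0 s j.
  move=> /andP [ij jl]; have := sorted_leq_nth leq_trans leqnn 0 ss.
  by apply; rewrite ?inE //; apply: leq_ltn_trans jl.
have := mem_nth 0 ks; rewrite ms -qk => /andP [qn oq].
set q := nth 0 Q' k in qk qn oq *.
have nxt y : outs pi A y -> q < y -> nth 0 Q' k.+1 <= y.
  move=> oy qy; have yn : y <= n.
    by have := nodes_le (x := y) hA; rewrite /nodes oy orbT; apply.
  have [en|ylt] : y = n \/ y < n by lia.
    rewrite en nth_rcons szs; case: ltnP => [h|_]; last by case: eqP.
    have : nth 0 s k.+1 \in s by rewrite mem_nth // szs.
    by rewrite ms => /andP [/ltnW].
  have ym : y \in s by rewrite ms ylt.
  have il : index y s < size s by rewrite index_mem.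
  have ki : k < index y s.
    rewrite ltnNge; apply/negP => h; have := mono (index y s) k.
    by rewrite h ks nth_index // -qk => /(_ isT); lia.
  rewrite nth_rcons (leq_ltn_trans ki il) -[X in _ <= X](nth_index 0 ym).
  by apply: mono; rewrite ki.
pose c := hat pi^-1 q.
have hcq : hat pi c = q by rewrite hatVK.
have Ac : A c by [].
have cn : c < n by rewrite hat_lt.
apply: (@leq_trans 3); last by lia.
rewrite ltnNge rcons_elems; apply/negP.
rewrite -size_filter; set t := [seq _ <- _ | _] => h3.
have st : sorted ltn t by apply: sorted_filter; [exact: ltn_trans | exact: elems_sorted].
have el i : i < 3 -> [/\ A (nth 0 t i), q < nth 0 t i & nth 0 t i < nth 0 Q' k.+1].
  move=> hi; have := mem_nth 0 (leq_trans hi h3); rewrite mem_filter mem_elems.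
  by move=> /and3P [/andP [-> ->] -> _].
have off i : i < 3 -> offset pi A c (nth 0 t i - q).
  move=> hi; have [h1 h2 h4] := el i hi.
  split; first by lia.
    apply/(gap_outs _ hA cn) => y hy; apply/negP => oy; rewrite hcq in hy.
    by have := nxt y oy ltac:(lia); lia.
  by rewrite hcq subnKC 1?ltnW // /nodes h1 orbT.
have tm i j : i < j < 3 -> nth 0 t i < nth 0 t j.
  move=> /andP [ij jl]; have := sorted_ltn_nth ltn_trans 0 st.
  by apply; rewrite ?inE //; lia.
apply: (sparse Ac cn); exists (nth 0 t 0 - q), (nth 0 t 1 - q), (nth 0 t 2 - q).
have [_ h0 _] := el 0 isT; have [_ h1 _] := el 1 isT.
have l1 := tm 0 1 isT; have l2 := tm 1 2 isT.
by split; try (by apply: off); lia.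
Qed.

End Result.

Notation idx A x := (size (elems A x)).

Lemma idx_mono (A : pred nat) x y : x <= y -> idx A x <= idx A y.
Proof. by move=> h; rewrite (elems_catE A h) size_cat leq_addr. Qed.

Lemma idxS (A : pred nat) x : idx A x.+1 = idx A x + A x.
Proof. by rewrite elems_rcons; case: (A x); rewrite ?size_rcons ?addn1 ?addn0. Qed.

Lemma idx_lt (A : pred nat) x y : A x -> x < y -> idx A x < idx A y.
Proof. by move=> Ax xy; have := idx_mono A xy; rewrite idxS Ax addn1. Qed.

Lemma first_elem (A : pred nat) n z : z <= n -> A n -> exists x,
  [/\ A x, z <= x <= n, elems A x = elems A z & forall y, z <= y < x -> ~~ A y].
Proof.
move=> zn An; have ex : exists x, (z <= x) && A x by exists n; rewrite zn.
case: (ex_minnP ex) => x /andP [zx Ax] mi; exists x; split=> //.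
- by rewrite zx; apply: mi; rewrite zn.
- rewrite (elems_catE A zx) [X in _ ++ X](_ : _ = [::]) ?cats0 //.
  rewrite -(filter_pred0 (iota z (x - z))); apply: eq_in_filter => y.
  rewrite mem_iota => hy; apply/negP => Ay; have := mi y.
  by rewrite Ay => /(_ ltac:(lia)); lia.
- by move=> y hy; apply/negP => Ay; have := mi y; rewrite Ay => /(_ ltac:(lia)); lia.
Qed.

Lemma nth_elems (A : pred nat) x y : A x -> x < y -> nth 0 (elems A y) (idx A x) = x.
Proof.
move=> Ax xy; rewrite (elems_catE A xy) elems_rcons Ax nth_cat size_rcons leqnn.
by rewrite nth_rcons ltnn eqxx.
Qed.

Lemma index_elems (A : pred nat) x y : A x -> x < y -> index x (elems A y) = idx A x.
Proof.
move=> Ax xy; rewrite -{1}(nth_elems Ax xy) index_uniq ?elems_uniq //.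
exact: idx_lt.
Qed.

Section Input.

Variables (n : nat) (pi : 'S_n).
Notation r := (nb_intervals pi).

Definition start_pred : pred nat :=
  fun x => (x == n) || (x < n) && starts_interval pi x.
Notation A0 := start_pred.
Notation Q0 := (outs pi A0).
Notation N0 := (nodes pi A0).

Lemma start_breakpoints : breakpoints pi A0.
Proof.
split; rewrite /A0 ?eqxx //.
- by move=> x /orP [/eqP ->//|/andP [/ltnW]].
- by move=> x -> ->; rewrite orbT.
Qed.

Lemma start_charged : well_charged pi A0.
Proof.
move=> c; rewrite /A0 => /orP [/eqP ->|/andP [_ ->]] //; by rewrite ltnn.
Qed.

Lemma elems_starts : elems A0 n = starts pi.
Proof.
apply: eq_in_filter => x; rewrite mem_iota /A0 => /= xn.
by rewrite xn (ltn_eqF xn).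
Qed.

Lemma idx_starts : idx A0 n = r.
Proof. by rewrite elems_starts. Qed.

Lemma P_arrE : P_arr pi = elems A0 n.+1.
Proof. by rewrite elems_rcons (bp_n start_breakpoints) elems_starts. Qed.

Lemma Q_arrE : Q_arr pi = elems Q0 n.+1.
Proof.
rewrite elems_rcons (outs_n start_breakpoints) /Q_arr; congr rcons.
rewrite /Ppi_arr -elems_starts (image_elems pi).
apply: (sorted_eq leq_trans anti_leq).
- exact: sort_sorted leq_total _.
- by apply: sub_sorted (elems_sorted _ _) => x y /ltnW.
rewrite perm_sort; apply: uniq_perm.
- by rewrite map_inj_uniq ?elems_uniq //; exact: hat_inj.
- exact: elems_uniq.
move=> y; rewrite mem_elems; apply/mapP/andP.
  by move=> [x]; rewrite mem_elems => /andP [Ax xn] ->; rewrite hat_lt outs_hat.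
move=> [oy yn]; exists (hat pi^-1 y); last by rewrite hatVK.
by rewrite mem_elems hat_lt yn andbT.
Qed.

Lemma idx_outs : idx Q0 n = r.
Proof.
have := count_outs pi A0; rewrite -!size_elems !idxS (bp_n start_breakpoints).
by rewrite (outs_n start_breakpoints) idx_starts => /addIn.
Qed.

Lemma cnt_start : idx N0 n.+1 <= idx A0 n.+1 + r.
Proof.
have h := count_predUI A0 Q0 (iota 0 n.+1).
rewrite !size_elems in h *.
have -> : count N0 (iota 0 n.+1) = count (predU A0 Q0) (iota 0 n.+1) by [].
have : 0 < count (predI A0 Q0) (iota 0 n.+1).
  rewrite -has_count; apply/hasP; exists n; first by rewrite mem_iota; lia.
  by rewrite /= (bp_n start_breakpoints) (outs_n start_breakpoints).
have e := idx_outs; have := idxS Q0 n; rewrite e (outs_n start_breakpoints) size_elems => e2.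
rewrite e2 in h.
move: h; move: (count (predU _ _) _) (count (predI _ _) _) (count A0 _) => a b c.
by lia.
Qed.

(* The arrays, indexed by breakpoint instead of by rank. *)
Definition static (M : nat -> nat) : Prop :=
  [/\ forall x, A0 x -> M (idx A0 x) = x,
      forall x, A0 x -> x < n -> M (r.+1 + idx A0 x) = hat pi x
    & forall x, A0 x -> x < n -> M (2 * r + 1 + idx A0 x) = idx Q0 (hat pi x)].

Lemma idxA_le x : x <= n -> idx A0 x <= r.
Proof. by move=> h; rewrite -idx_starts; apply: idx_mono. Qed.

Lemma idxA_lt x : A0 x -> x < n -> idx A0 x < r.
Proof. by move=> h1 h2; rewrite -idx_starts; apply: idx_lt. Qed.

Lemma idxQ_le x : x <= n -> idx Q0 x <= r.
Proof. by move=> h; rewrite -idx_outs; apply: idx_mono. Qed.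

Lemma static_input M :
  array_at M 0 (P_arr pi ++ Ppi_arr pi ++ tau_arr pi) -> static M.
Proof.
move=> h.
have szP : size (P_arr pi) = r.+1.
  by rewrite P_arrE elems_rcons (bp_n start_breakpoints) size_rcons idx_starts.
have szI : size (Ppi_arr pi) = r by rewrite size_map.
have szT : size (tau_arr pi) = r by rewrite size_map.
have PpiE x : A0 x -> x < n -> nth 0 (Ppi_arr pi) (idx A0 x) = hat pi x.
  move=> Ax xn; rewrite /Ppi_arr /image_of -elems_starts.
  by rewrite (nth_map 0) ?nth_elems ?papply_hat //; apply: idx_lt.
split.
- move=> x Ax; have xn := bp_le start_breakpoints Ax; have := idxA_le xn => il.
  rewrite -[idx A0 x]add0n h; last by rewrite size_cat szP; lia.
  by rewrite nth_cat szP ltnS il P_arrE nth_elems.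
- move=> x Ax xn; have il := idxA_lt Ax xn.
  rewrite -[X in M X]add0n h; last by rewrite !size_cat szP szI; lia.
  rewrite nth_cat szP ltnNge leq_addr /= addKn nth_cat szI il; exact: PpiE.
- move=> x Ax xn; have il := idxA_lt Ax xn.
  rewrite (_ : 2 * r + 1 + idx A0 x = 0 + (r.+1 + (r + idx A0 x))); last by lia.
  rewrite h; last by rewrite !size_cat szP szI szT; lia.
  rewrite nth_cat szP ltnNge leq_addr /= addKn nth_cat szI ltnNge leq_addr /= addKn.
  rewrite (nth_map 0) ?szI // PpiE // Q_arrE index_elems ?outs_hat //.
  by rewrite ltnS hat_le ltnW.
Qed.

Hypothesis r0 : 0 < r.

Lemma static_frame M M' : (forall a, a < 4 * r -> M' a = M a) -> static M -> static M'.
Proof.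
move=> e [h1 h2 h3]; split.
- move=> x Ax; rewrite e ?h1 //; have := idxA_le (bp_le start_breakpoints Ax).
  by clear -r0; lia.
- by move=> x Ax xn; rewrite e ?h2 //; have := idxA_lt Ax xn; clear; lia.
- by move=> x Ax xn; rewrite e ?h3 //; have := idxA_lt Ax xn; clear; lia.
Qed.

End Input.

(** * Memory representation *)

Section Cursor.

Variables (n : nat) (pi : 'S_n) (A : pred nat) (a : nat).
Hypotheses (hA : breakpoints pi A) (an : a < n).

Definition cursor (o u v : nat) : Prop :=
  [/\ gap A a o, is_next (nodes pi A) (a + o) u
    & is_next (nodes pi A) (hat pi a + o) v].

Lemma cursor_le o u v : cursor o u v ->
  [/\ a + o < u, hat pi a + o < v, u <= n & v <= n].
Proof.
by move=> [g [h1 h2 h3] [h4 h5 h6]]; split=> //; apply: (nodes_le hA).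
Qed.

Lemma offset_lt o : offset pi A a o -> a + o < n /\ hat pi a + o < n.
Proof.
move=> [_ g _]; have lt := gap_lt hA an g; split=> //.
by rewrite -(contiguous hA an g) hat_lt.
Qed.

Lemma cursor_end o u v : cursor o u v -> u - a = v - hat pi a -> A u ->
  forall o', offset pi A a o' -> o' <= o.
Proof.
move=> hc e Au o' [p g h]; have [l1 l2 l3 l4] := cursor_le hc.
have [g0 [h1 h2 h3] [h4 h5 h6]] := hc.
rewrite leqNgt; apply/negP => lo.
case: (ltnP (a + o') u) => lu; last first.
  by have := g u; rewrite Au => /(_ ltac:(clear h; lia)).
case/orP: h => h.
- by have := h3 (a + o'); rewrite h => /(_ ltac:(lia)).
- by have := h6 (hat pi a + o'); rewrite h => /(_ ltac:(lia)).
Qed.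

Lemma cursor_gap o u v : cursor o u v ->
  gap A a (minn (u - a) (v - hat pi a)).-1.
Proof.
move=> hc y hy; have [l1 l2 l3 l4] := cursor_le hc.
have [g0 [h1 h2 h3] [h4 h5 h6]] := hc.
case: (leqP y (a + o)) => ly; first by apply: g0; lia.
by have := h3 y ltac:(lia); rewrite /nodes negb_or => /andP [].
Qed.

Lemma cursor_next o u v : cursor o u v ->
  ~~ (A u && (u - a == v - hat pi a)) ->
  let e := minn (u - a) (v - hat pi a) in
  [/\ o < e, offset pi A a e & forall o', offset pi A a o' -> o < o' -> e <= o'].
Proof.
move=> hc ne e; have [l1 l2 l3 l4] := cursor_le hc.
have [g0 [h1 h2 h3] [h4 h5 h6]] := hc.
have oe : o < e by rewrite /e; lia.
have ge := cursor_gap hc; rewrite -/e in ge.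
have Ne : nodes pi A (a + e) || nodes pi A (hat pi a + e).
  case: (leqP (u - a) (v - hat pi a)) => le.
    by rewrite (_ : a + e = u) ?h2 // /e; lia.
  by rewrite (_ : hat pi a + e = v) ?h5 ?orbT // /e; lia.
split=> //; last first.
  move=> o' [p' g' h'] lo; rewrite leqNgt; apply/negP => lt.
  case/orP: h' => h'.
  - by have := h3 (a + o'); rewrite h' => /(_ ltac:(rewrite /e in lt; lia)).
  - by have := h6 (hat pi a + o'); rewrite h' => /(_ ltac:(rewrite /e in lt; lia)).
have nA : ~~ A (a + e).
  apply/negP => Ae; case/negP: ne.
  have eu : u = a + e.
    apply/eqP; rewrite eqn_leq; apply/andP; split; last by rewrite /e; lia.
    rewrite leqNgt; apply/negP => lt.
    by have := h3 (a + e); rewrite /nodes Ae => /(_ ltac:(lia)).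
  have ev : v = hat pi a + e.
    apply/eqP; rewrite eqn_leq; apply/andP; split; last by rewrite /e; lia.
    rewrite leqNgt; apply/negP => lt.
    have := h6 (hat pi a + e) ltac:(lia); rewrite /nodes negb_or => /andP [_].
    case/negP; rewrite -(prednK (leq_ltn_trans (leq0n _) oe)).
    by apply: outs_end => //; rewrite prednK //; apply: leq_ltn_trans oe.
  by rewrite {1}eu Ae /= eu ev !addKn.
split=> //; first lia.
move=> y hy; have [ly|->] : y <= a + e.-1 \/ y = a + e by lia.
  by apply: ge; lia.
exact: nA.
Qed.

Lemma is_next_shift (N : pred nat) x y z : is_next N x z -> x <= y < z -> is_next N y z.
Proof. by move=> [h1 h2 h3] h; split=> //; [lia | move=> t ht; apply: h3; lia]. Qed.

Lemma cursor_move o e u v u' v' : cursor o u v ->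
  e = minn (u - a) (v - hat pi a) ->
  offset pi A a e ->
  (if u == a + e then is_next (nodes pi A) u u' else u' = u) ->
  (if v == hat pi a + e then is_next (nodes pi A) v v' else v' = v) ->
  cursor e u' v'.
Proof.
move=> hc ee [p g _]; have [l1 l2 l3 l4] := cursor_le hc.
have [g0 n1 n2] := hc.
case: eqP => [eu|nu] hu; case: eqP => [ev|nv] hv; split; rewrite -?eu -?ev //.
- by rewrite hv; apply: (is_next_shift n2); lia.
- by rewrite hu; apply: (is_next_shift n1); lia.
- by rewrite hu; apply: (is_next_shift n1); lia.
- by rewrite hv; apply: (is_next_shift n2); lia.
Qed.

End Cursor.

Section Representation.

Variables (n : nat) (pi : 'S_n) (base : nat).

Definition node_addr (slot : nat -> nat) (x : nat) : nat := base + 6 * slot x.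

(* A node takes six words: its position, the next and previous nodes, the node
   of its image if it is an input breakpoint, the node of its preimage if it is
   an output breakpoint (0 otherwise), and one word for its rank. *)
Record rep (N A : pred nat) (slot : nat -> nat) (cnt : nat) (m : nat -> nat)
    : Prop := Rep {
  rep_inj : forall x y, N x -> N y -> slot x = slot y -> x = y;
  rep_lt : forall x, N x -> slot x < cnt;
  rep_pos : forall x, N x -> m (node_addr slot x + 0) = x;
  rep_nxt : forall x y, N x -> is_next N x y -> m (node_addr slot x + 1) = node_addr slot y;
  rep_prv : forall x y, N x -> is_next N x y -> m (node_addr slot y + 2) = node_addr slot x;
  rep_img : forall x, N x ->
    m (node_addr slot x + 3) = if A x then node_addr slot (hat pi x) else 0;
  rep_pre : forall x, N x ->
    m (node_addr slot x + 4) = if outs pi A x then node_addr slot (hat pi^-1 x) else 0;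
  rep_head : slot 0 = 0 }.

Lemma rep_frame N A slot cnt m m' :
  (forall x, base <= x -> m' x = m x) ->
  rep N A slot cnt m -> rep N A slot cnt m'.
Proof.
move=> e [h1 h2 h3 h4 h5 h6 h7 h8].
have e' x f : m' (node_addr slot x + f) = m (node_addr slot x + f).
  by apply: e; rewrite /node_addr; lia.
by split=> // *; rewrite e'; auto.
Qed.

Lemma is_next_eq (N N' : pred nat) x y : N =1 N' -> is_next N' x y -> is_next N x y.
Proof. by move=> e [h1 h2 h3]; split=> //; rewrite ?e // => z /h3; rewrite e. Qed.

Lemma rep_eq N N' A A' slot cnt m : N =1 N' -> A =1 A' ->
  rep N A slot cnt m -> rep N' A' slot cnt m.
Proof.
move=> e eA [h1 h2 h3 h4 h5 h6 h7 h8].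
split=> [x y|x|x|x y|x y|x|x|]; rewrite -?e -?eA /outs -?eA; auto.
- by move=> hx /(is_next_eq e); apply: h4.
- by move=> hx /(is_next_eq e); apply: h5.
Qed.

Lemma rep_link N A slot cnt m p : rep N A slot cnt m -> N p -> N (hat pi p) ->
  rep N (fun x => A x || (x == p)) slot cnt
    (upd (upd m (node_addr slot p + 3) (node_addr slot (hat pi p)))
       (node_addr slot (hat pi p) + 4) (node_addr slot p)).
Proof.
move=> [h1 h2 h3 h4 h5 h6 h7 h8] Np Nh.
have rd x f : f != 3 -> f != 4 -> f < 6 ->
    upd (upd m (node_addr slot p + 3) (node_addr slot (hat pi p)))
       (node_addr slot (hat pi p) + 4) (node_addr slot p) (node_addr slot x + f) =
    m (node_addr slot x + f).
  by move=> f3 f4 f6; rewrite !upd_diff //; rewrite /node_addr; lia.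
split=> //; try by move=> *; rewrite rd //; auto.
- move=> x Nx; rewrite upd_diff; last by rewrite /node_addr; lia.
  case: (eqVneq x p) => [->|xp]; first by rewrite upd_same orbT.
  rewrite orbF upd_diff; first exact: h6.
  apply: contra xp => /eqP e; apply/eqP; apply: h1 => //.
  by move: e; rewrite /node_addr; lia.
- move=> x Nx; rewrite /outs; case: (eqVneq x (hat pi p)) => [->|xp].
    by rewrite upd_same hatK eqxx orbT.
  rewrite upd_diff; last first.
    apply: contra xp => /eqP e; apply/eqP; apply: h1 => //.
    by move: e; rewrite /node_addr; lia.
  rewrite upd_diff; last by rewrite /node_addr; lia.
  rewrite (_ : hat pi^-1 x == p = false) ?orbF; first exact: h7.
  by apply/negbTE; apply: contra xp => /eqP <-; rewrite hatVK.
Qed.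

Definition insert_mem (m : nat -> nat) (q y w u : nat) : nat -> nat :=
  upd (upd (upd (upd (upd (upd (upd m (q + 0) y) (q + 1) u) (q + 2) w)
    (q + 3) 0) (q + 4) 0) (w + 1) q) (u + 2) q.

Lemma rep_insert N A slot cnt m w u y :
  rep N A slot cnt m -> N w -> is_next N w u -> w < y < u ->
  ~~ A y -> ~~ outs pi A y -> (forall x, A x -> N (hat pi x) && N x) ->
  rep (fun x => N x || (x == y)) A (upd slot y cnt) cnt.+1
    (insert_mem m (base + 6 * cnt) y (node_addr slot w) (node_addr slot u)).
Proof.
move=> [h1 h2 h3 h4 h5 h6 h7 h8] Nw nwu wyu Ay Oy AN.
have [wu Nu nwuz] := nwu.
have Ny : ~~ N y by apply: nwuz.
have ne x : N x -> x != y by move=> Nx; apply: contraNneq Ny => <-.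
have sl x : N x -> upd slot y cnt x = slot x by move=> /ne; apply: upd_diff.
have sy : upd slot y cnt y = cnt by apply: upd_same.
have ad x : N x -> node_addr (upd slot y cnt) x = node_addr slot x.
  by move=> /sl e; rewrite /node_addr e.
have ady : node_addr (upd slot y cnt) y = base + 6 * cnt by rewrite /node_addr sy.
have lx x : N x -> node_addr slot x + 6 <= base + 6 * cnt.
  by move=> /h2; rewrite /node_addr; lia.
have inj x z : N x -> N z -> x != z ->
    node_addr slot x + 6 <= node_addr slot z \/ node_addr slot z + 6 <= node_addr slot x.
  move=> Nx Nz xz; have : slot x != slot z by apply: contra xz => /eqP /h1 ->.
  by rewrite /node_addr; lia.
have rd x f : N x -> f < 6 -> f != 1 -> f != 2 ->
    insert_mem m (base + 6 * cnt) y (node_addr slot w) (node_addr slot u) (node_addr slot x + f)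
    = m (node_addr slot x + f).
  move=> Nx f6 f1 f2; have := lx _ Nx; rewrite /insert_mem => l.
  by rewrite !upd_diff //; try (by lia); rewrite /node_addr; lia.
have rd1 x : N x -> x != w ->
    insert_mem m (base + 6 * cnt) y (node_addr slot w) (node_addr slot u) (node_addr slot x + 1)
    = m (node_addr slot x + 1).
  move=> Nx xw; have := lx _ Nx; rewrite /insert_mem => l; have := inj _ _ Nx Nw xw => d.
  by rewrite !upd_diff //; try (by lia); rewrite /node_addr; lia.
have rd2 x : N x -> x != u ->
    insert_mem m (base + 6 * cnt) y (node_addr slot w) (node_addr slot u) (node_addr slot x + 2)
    = m (node_addr slot x + 2).
  move=> Nx xw; have := lx _ Nx; rewrite /insert_mem => l; have := inj _ _ Nx Nu xw => d.
  by rewrite !upd_diff //; try (by lia); rewrite /node_addr; lia.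
have lw := lx _ Nw; have lu := lx _ Nu.
have AN' x : A x -> x != y by apply: contraTneq => ->.
have nwy : is_next (fun x => N x || (x == y)) w y.
  split; [lia | by rewrite eqxx orbT |].
  by move=> z hz; rewrite negb_or nwuz ?andTb; lia.
have nyu : is_next (fun x => N x || (x == y)) y u.
  split; [lia | by rewrite Nu |].
  by move=> z hz; rewrite negb_or nwuz ?andTb; lia.
have nold x z : N x -> x != w -> is_next (fun x => N x || (x == y)) x z ->
    is_next N x z /\ N z.
  move=> Nx xw nx; have [xz Nz nz] := nx.
  have zy : z != y.
    apply: contra xw => /eqP e; rewrite e in nx; apply/eqP.
    apply: (is_next_inj (N := fun x => N x || (x == y)) _ _ nx nwy); by rewrite ?Nx ?Nw.
  have Nz' : N z by move: Nz; rewrite (negbTE zy) orbF.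
  split=> //; split=> // t /nz; by rewrite negb_or => /andP [].
split.
- move=> x z /orP [Nx|/eqP ->] /orP [Nz|/eqP ->] //; rewrite ?sy ?sl //.
  + exact: h1.
  + by have := h2 _ Nx; lia.
  + by have := h2 _ Nz; lia.
- by move=> x /orP [Nx|/eqP ->]; rewrite ?sy ?sl //; have := h2 _ Nx; lia.
- move=> x /orP [Nx|/eqP ->]; first by rewrite ad // rd // h3.
  by rewrite ady /insert_mem; rd_upd.
- move=> x z /orP [Nx|/eqP ->].
    case: (eqVneq x w) => [->|xw].
      move=> nz; rewrite (is_next_fun nz nwy) ad // ady /insert_mem.
      by rewrite upd_diff ?upd_same //; rewrite /node_addr; lia.
    move=> /nold [] // nz Nz; rewrite !ad // rd1 //; exact: h4.
  move=> nz; rewrite (is_next_fun nz nyu) ady ad // /insert_mem.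
  by rd_upd.
- move=> x z /orP [Nx|/eqP ->].
    case: (eqVneq x w) => [->|xw].
      move=> nz; rewrite (is_next_fun nz nwy) (ad w) // ady /insert_mem.
      by rd_upd.
    move=> /nold [] // nz Nz; rewrite !ad // rd2 //; first exact: h5.
    by apply: contra xw => /eqP e; rewrite e in nz; apply/eqP/(is_next_inj Nx Nw nz nwu).
  move=> nz; rewrite (is_next_fun nz nyu) ady ad // /insert_mem.
  by rewrite upd_same.
- move=> x /orP [Nx|/eqP ->].
    rewrite ad // rd // h6 //; case: ifP => // /AN /andP [Nh _]; by rewrite ad.
  by rewrite ady (negbTE Ay) /insert_mem; rd_upd.
- move=> x /orP [Nx|/eqP ->].
    by rewrite ad // rd // h7 //; case: ifP => // /AN /andP [_ Nh]; rewrite ad.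
  by rewrite ady (negbTE Oy) /insert_mem; rd_upd.
- by rewrite upd_diff //; lia.
Qed.

Lemma rep_rank N A slot cnt m x v : rep N A slot cnt m ->
  rep N A slot cnt (upd m (node_addr slot x + 5) v).
Proof.
move=> [h1 h2 h3 h4 h5 h6 h7 h8].
have rd y f : f < 5 ->
    upd m (node_addr slot x + 5) v (node_addr slot y + f) = m (node_addr slot y + f).
  by move=> f5; rewrite upd_diff //; rewrite /node_addr; lia.
by split=> // *; rewrite rd //; auto.
Qed.

End Representation.

(** * The program *)

Notation "a ;; b" := (Seq a b) (at level 61, right associativity).
Notation SET d v := (Op (OSet d v)).
Notation MOV d a := (Op (OMov d a)).
Notation ADD d a b := (Op (OAdd d a b)).
Notation ADDI d a k := (Op (OAddI d a k)).
Notation MULI d a k := (Op (OMulI d a k)).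
Notation SUB d a b := (Op (OSub d a b)).
Notation LD d a k := (Op (OLd d a k)).
Notation ST a k s := (Op (OSt a k s)).

(* With r = R_0, memory holds the input arrays below 4r, the sorted output
   breakpoints at 4r, the nodes of the input and of the output breakpoints at 6r
   and 8r, the stack at 10r, the three arrays of the result at 20r, 24r and 28r,
   and the list nodes from 32r on. R_4 = n, R_8 is the stack pointer, R_9 = 10r
   the bottom of the stack, and R_14 the address of the next free node. *)

(* R_19 and R_20 are the next nodes in the input interval starting at position
   R_17 and in its image starting at position R_18; R_26 is cleared when both
   have reached the end. *)
Definition advance : cmd :=
  SET 26 1 ;; LD 21 19 0 ;; SUB 21 21 17 ;; LD 22 20 0 ;; SUB 22 22 18 ;;
  If (CLt 21 22) (LD 19 19 1 ;; Skip)
    (If (CLt 22 21) (LD 20 20 1 ;; Skip)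
      (LD 23 19 3 ;;
       If (CZ 23) (LD 19 19 1 ;; LD 20 20 1 ;; Skip) (SET 26 0 ;; Skip))).

Definition insert_before (x : nat) : cmd :=
  LD 27 x 2 ;; ST 14 0 26 ;; ST 14 1 x ;; ST 14 2 27 ;; ST 14 3 28 ;;
  ST 14 4 28 ;; ST 27 1 14 ;; ST x 2 14 ;; MOV x 14 ;; ADDI 14 14 6 ;; Skip.

Definition push (x : nat) : cmd := ST 8 0 x ;; ADDI 8 8 1 ;; Skip.

Definition back (f : nat) : cmd :=
  LD 27 26 f ;; If (CZ 27) (LD 26 26 2 ;; Skip) Skip.

(* Field [f] of a node is zero unless the node is an output breakpoint ([f = 4])
   or an input breakpoint ([f = 3]). *)
Definition walk (f src dst : nat) : cmd :=
  MOV 26 src ;; back f ;; back f ;; back f ;; LD 27 26 f ;;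
  If (CZ 27) Skip (push dst).

(* R_24 and R_25 are the first nodes at or after the two cut points; at most one
   of the cut points is not a node yet. *)
Definition place : cmd :=
  LD 21 24 0 ;; SUB 21 21 17 ;; LD 22 25 0 ;; SUB 22 22 18 ;; SET 28 0 ;;
  If (CLt 22 21) (ADD 26 17 22 ;; insert_before 24)
    (If (CLt 21 22) (ADD 26 18 21 ;; insert_before 25) Skip).

Definition split_interval : cmd :=
  place ;; ST 24 3 25 ;; ST 25 4 24 ;; push 24 ;; walk 4 24 27 ;; walk 3 25 26.

Definition main_body : cmd :=
  SET 21 1 ;; SUB 8 8 21 ;; LD 15 8 0 ;; LD 16 15 3 ;; LD 17 15 0 ;; LD 18 16 0 ;;
  LD 19 15 1 ;; LD 20 16 1 ;; advance ;; MOV 24 19 ;; MOV 25 20 ;; advance ;; advance ;;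
  If (CZ 26) Skip split_interval.

Definition init_setup : cmd :=
  MULI 5 0 4 ;; MULI 6 0 6 ;; MULI 7 0 8 ;; MULI 9 0 10 ;; MOV 8 9 ;;
  MULI 14 0 32 ;; LD 4 0 0 ;; ADD 15 5 0 ;; ST 15 0 4 ;; SET 16 0 ;; Skip.

Definition sort_body : cmd :=
  ADD 17 16 0 ;; LD 18 17 1 ;; ADD 17 17 0 ;; LD 19 17 1 ;; ADD 19 19 5 ;;
  ST 19 0 18 ;; ADDI 16 16 1 ;; Skip.

Definition merge_setup : cmd :=
  SET 15 0 ;; SET 16 0 ;; ADDI 20 0 1 ;; SET 21 0 ;; MOV 23 14 ;; Skip.

Definition merge_body : cmd :=
  LD 17 15 0 ;; ADD 18 16 5 ;; LD 19 18 0 ;; ST 14 3 21 ;; ST 14 4 21 ;;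
  ADDI 22 14 6 ;; ST 14 1 22 ;; ST 14 2 23 ;; MOV 23 14 ;;
  If (CLt 19 17) (ST 14 0 19 ;; Skip)
    (ST 14 0 17 ;; ADD 24 15 6 ;; ST 24 0 14 ;; ADDI 15 15 1 ;; Skip) ;;
  If (CLt 17 19) Skip (ADD 24 16 7 ;; ST 24 0 14 ;; ADDI 16 16 1 ;; Skip) ;;
  MOV 14 22 ;; Skip.

Definition link_setup : cmd := ST 23 3 23 ;; ST 23 4 23 ;; SET 16 0 ;; Skip.

Definition link_body : cmd :=
  ADD 17 16 6 ;; LD 18 17 0 ;; ADD 17 16 0 ;; ADD 17 17 0 ;; LD 19 17 1 ;;
  ADD 19 19 7 ;; LD 19 19 0 ;; ST 18 3 19 ;; ST 19 4 18 ;; ST 8 0 18 ;;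
  ADDI 8 8 1 ;; ADDI 16 16 1 ;; Skip.

Definition initialise : cmd :=
  init_setup ;; While (CLt 16 0) sort_body ;; merge_setup ;;
  While (CLt 15 20) merge_body ;; link_setup ;; While (CLt 16 0) link_body.

Definition out_init : cmd :=
  MULI 13 0 32 ;; MULI 10 0 20 ;; MULI 11 0 24 ;; MULI 12 0 28 ;; SET 21 1 ;;
  MOV 15 13 ;; SET 16 0 ;; LD 22 15 0 ;; Skip.

Definition rank_body : cmd :=
  LD 17 15 3 ;; If (CZ 17) Skip (ADDI 16 16 1 ;; Skip) ;; SUB 20 16 21 ;;
  ST 15 5 20 ;; LD 15 15 1 ;; LD 22 15 0 ;; Skip.

Definition out_reset : cmd := MOV 15 13 ;; SET 16 0 ;; LD 22 15 0 ;; Skip.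

Definition out_body : cmd :=
  LD 17 15 3 ;;
  If (CZ 17) Skip
    (LD 18 15 0 ;; ADD 19 10 16 ;; ST 19 0 18 ;;
     LD 18 17 0 ;; ADD 19 11 16 ;; ST 19 0 18 ;;
     LD 18 17 5 ;; ADD 19 12 16 ;; ST 19 0 18 ;; ADDI 16 16 1 ;; Skip) ;;
  LD 15 15 1 ;; LD 22 15 0 ;; Skip.

Definition out_end : cmd :=
  ADD 19 10 16 ;; ST 19 0 4 ;; MOV 0 16 ;; MOV 1 10 ;; MOV 2 11 ;; MOV 3 12 ;; Skip.

Definition output : cmd :=
  out_init ;; While (CLt 22 4) rank_body ;; out_reset ;;
  While (CLt 22 4) out_body ;; out_end.

Definition move_cmd : cmd :=
  initialise ;; While (CLt 9 8) main_body ;; output.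

(** * Correctness of the program *)

Ltac isnum x := lazymatch x with O => idtac | Datatypes.S ?y => isnum y end.

Ltac regs := repeat match goal with |- context [upd ?f ?a ?v ?x] =>
  isnum a; isnum x;
  let e := eval compute in (Nat.eqb x a) in
  lazymatch e with
  | true => change (upd f a v x) with v
  | false => change (upd f a v x) with (f x)
  end end.

Ltac frame := let i := fresh "i" in let hi := fresh "hi" in
  move=> i hi; rewrite !(upd_notin _ _ hi) //.

Ltac exec :=
  match goal with h : is_true (_ <= 2 ^ _) |- _ => apply: (ok_op h) end;
  [rewrite /op_pre; regs | rewrite /op_regs /op_mem; regs].

Lemma array_at_rcons (m : nat -> nat) b s v x : x = b + size s ->
  array_at m b s -> array_at (upd m x v) b (rcons s v).
Proof.
move=> -> h i; rewrite size_rcons nth_rcons => hi.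
have [lt|->] : i < size s \/ i = size s by lia.
  by rewrite lt upd_diff ?h //; lia.
by rewrite ltnn eqxx upd_same.
Qed.

Lemma array_at_upd (m : nat -> nat) b s v x : (x < b) || (b + size s <= x) ->
  array_at m b s -> array_at (upd m x v) b s.
Proof. by move=> hx h i hi; rewrite upd_diff ?h //; lia. Qed.

Section Program.

Variables (n : nat) (pi : 'S_n) (w : nat).
Notation r := (nb_intervals pi).
Notation S := (64 * r).
Notation base := (32 * r).
Hypotheses (n0 : 0 < n) (r0 : 0 < r) (S_le : S <= 2 ^ w) (n_lt : n < 2 ^ w).

Notation ok c Q R M := (okT w S c (csize c) Q R M).
Notation cnt A := (count (nodes pi A) (iota 0 n.+1)).
Notation addr := (node_addr base).
Notation rep := (rep pi base).

Definition stack (stk : seq nat) (A : pred nat) (slot R M : nat -> nat) : Prop :=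
  [/\ R 8 = 10 * r + size stk,
      forall i, i < size stk -> M (10 * r + i) = addr slot (nth 0 stk i)
    & forall c, c \in stk -> A c /\ c < n].

Lemma push_ok x stk A slot c R M : x \in [:: 24; 26; 27] ->
  R x = addr slot c -> stack stk A slot R M -> A c -> c < n -> size stk < 10 * r ->
  ok (push x) (fun R' M' => [/\ stack (rcons stk c) A slot R' M',
      forall i, i \notin [:: 8; 30] -> R' i = R i
    & forall y, base <= y -> M' y = M y]) R M.
Proof.
move=> hx Rx [R8 hM hs] Ac cn sz.
have fin R' : R' 8 = 10 * r + size stk + 1 ->
    stack (rcons stk c) A slot R' (upd M (10 * r + size stk + 0) (addr slot c)) /\
    (forall y, base <= y -> upd M (10 * r + size stk + 0) (addr slot c) y = M y).
  move=> e; split; last by move=> y hy; rewrite upd_diff //; lia.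
  split; first by rewrite e size_rcons; lia.
    move=> i; rewrite size_rcons nth_rcons => hi.
    case: ltnP => h; first by rewrite upd_diff ?hM //; lia.
    by rewrite (_ : i = size stk) ?eqxx ?addn0 ?upd_same //; lia.
  by move=> d; rewrite mem_rcons inE => /orP [/eqP ->|/hs].
move: hx Rx; rewrite !inE => /or3P [] /eqP -> Rx.
all: exec; first by rewrite R8; lia.
all: exec; first by rewrite R8; lia.
all: rewrite R8 Rx; apply: ok_skip.
all: match goal with |- [/\ stack _ _ _ ?R' _, _ & _] =>
  have [h1 h2] := fin R' erefl; split; [exact: h1 | by frame | exact: h2] end.
Qed.

Section Body.

Variables (A : pred nat) (slot : nat -> nat) (c : nat) (M : nat -> nat).
Hypotheses (hA : breakpoints pi A) (hr : rep (nodes pi A) A slot c M).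
Hypothesis (hc : c <= 5 * r).

Lemma addr_lt x k : nodes pi A x -> k < 6 -> addr slot x + k < S.
Proof. by move=> /(rep_lt hr); rewrite /node_addr; clear -hc; lia. Qed.

Lemma addr_gt0 s x : addr s x != 0.
Proof. by rewrite /node_addr; clear -r0; lia. Qed.

Lemma advance_ok R a o u v : A a -> a < n -> cursor pi A a o u v ->
  R 17 = a -> R 18 = hat pi a -> R 19 = addr slot u -> R 20 = addr slot v ->
  ok advance (fun R' M' => [/\ M' = M,
      forall i, i \notin [:: 19; 20; 21; 22; 23; 26; 30] -> R' i = R i
    & [/\ R' 26 = 0, R' 19 = R 19, R' 20 = R 20, A u & u - a = v - hat pi a] \/
      [/\ R' 26 = 1, ~~ (A u && (u - a == v - hat pi a))
        & exists u' v', [/\ cursor pi A a (minn (u - a) (v - hat pi a)) u' v',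
            R' 19 = addr slot u' & R' 20 = addr slot v']]]) R M.
Proof.
move=> Aa an cu R17 R18 R19 R20.
have [l1 l2 l3 l4] := cursor_le hA cu.
have [g0 [_ Nu _] [_ Nv _]] := cu.
have Nn : nodes pi A n by rewrite /nodes (bp_n hA).
have nxt x : nodes pi A x -> x < n -> exists2 y, is_next (nodes pi A) x y &
    M (addr slot x + 1) = addr slot y.
  move=> Nx xn; have [h _] := nextpP xn Nn; eexists; first exact: h.
  exact: (rep_nxt hr Nx h).
exec; first lia.
exec; first by rewrite R19; apply: addr_lt.
rewrite R19 (rep_pos hr Nu).
exec; first by rewrite R17; lia.
rewrite R17.
exec; first by rewrite R20; apply: addr_lt.
rewrite R20 (rep_pos hr Nv).
exec; first by rewrite R18; lia.
rewrite R18; apply: ok_if; rewrite /cond_eval /cond_regs; regs => c1.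
  have ne : ~~ (A u && (u - a == v - hat pi a)) by rewrite negb_and; lia.
  have [oe of_ mi] := cursor_next hA an cu ne.
  have [un _] := offset_lt hA an of_; rewrite (_ : a + _ = u) in un; last lia.
  have [u' nu eu] := nxt u Nu un.
  exec; first by rewrite R19; apply: addr_lt.
  apply: ok_skip; split=> //; first by frame.
  right; regs; split=> //; exists u', v; rewrite R19; split=> //.
  apply: (cursor_move hA an cu erefl of_); first by case: eqP => // ?; lia.
  by case: eqP => // ?; lia.
apply: ok_if; rewrite /cond_eval /cond_regs; regs => c2.
  have ne : ~~ (A u && (u - a == v - hat pi a)) by rewrite negb_and; lia.
  have [oe of_ mi] := cursor_next hA an cu ne.
  have [_ vn] := offset_lt hA an of_; rewrite (_ : hat pi a + _ = v) in vn; last lia.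
  have [v' nv ev] := nxt v Nv vn.
  exec; first by rewrite R20; apply: addr_lt.
  apply: ok_skip; split=> //; first by frame.
  right; regs; split=> //; exists u, v'; rewrite R20; split=> //.
  apply: (cursor_move hA an cu erefl of_); first by case: eqP => // ?; lia.
  by case: eqP => // ?; lia.
exec; first by rewrite R19; apply: addr_lt.
rewrite R19 (rep_img hr Nu).
apply: ok_if; rewrite /cond_eval /cond_regs; regs => c3.
  have nAu : ~~ A u by apply: contraTN c3 => ->; exact: addr_gt0.
  have ne : ~~ (A u && (u - a == v - hat pi a)) by rewrite (negbTE nAu).
  have [oe of_ mi] := cursor_next hA an cu ne.
  have [un vn] := offset_lt hA an of_.
  rewrite (_ : a + _ = u) in un; last lia.
  rewrite (_ : hat pi a + _ = v) in vn; last lia.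
  have [u' nu eu] := nxt u Nu un; have [v' nv ev] := nxt v Nv vn.
  exec; first by rewrite R19; apply: addr_lt.
  exec; first by rewrite R20; apply: addr_lt.
  apply: ok_skip; split=> //; first by frame.
  right; regs; split=> //; exists u', v'; rewrite R19 R20; split=> //.
  apply: (cursor_move hA an cu erefl of_); first by case: eqP => // ?; lia.
  by case: eqP => // ?; lia.
exec; first lia.
apply: ok_skip; split=> //; first by frame.
left; regs; split=> //; last by lia.
by move: c3; case: (A u).
Qed.

Lemma back_ok f (Q : pred nat) R y : f < 6 ->
  (forall x, nodes pi A x -> (M (addr slot x + f) == 0) = ~~ Q x) ->
  Q 0 -> nodes pi A y -> R 26 = addr slot y ->
  ok (back f) (fun R' M' => [/\ M' = M,
      forall i, i \notin [:: 26; 27; 30] -> R' i = R i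
    & exists y', [/\ R' 26 = addr slot y', nodes pi A y', y' <= y
        & back_step (nodes pi A) Q y y']]) R M.
Proof.
move=> f6 hQ Q0 Ny R26.
exec; first by rewrite R26; apply: addr_lt.
apply: ok_if; rewrite /cond_eval /cond_regs; regs; rewrite R26 hQ // => c1.
  have y0 : 0 < y by rewrite lt0n; apply: contraNneq c1 => ->.
  have N0 : nodes pi A 0 by rewrite /nodes (bp_0 hA).
  have [y' Ny' ny'] := prev_exists y0 N0 Ny.
  exec; first by rewrite R26; apply: addr_lt.
  rewrite R26 (rep_prv hr Ny' ny').
  apply: ok_skip; split=> //; first by frame.
  exists y'; regs; split=> //; first by case: ny' => /ltnW.
  by rewrite /back_step (negbTE c1).
apply: ok_skip; split=> //; first by frame.
exists y; regs; split=> //.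
by rewrite /back_step; rewrite negbK in c1; rewrite c1.
Qed.

Lemma walk_ok f src dst (Q : pred nat) (tgt : nat -> nat) R stk y :
  (f, src, dst) \in [:: (4, 24, 27); (3, 25, 26)] ->
  (forall x, nodes pi A x -> (M (addr slot x + f) == 0) = ~~ Q x) ->
  (forall x, nodes pi A x -> Q x ->
     (if dst == 27 then M (addr slot x + f) else addr slot x) = addr slot (tgt x)) ->
  (forall x, Q x -> x < n -> A (tgt x) /\ tgt x < n) ->
  Q 0 -> nodes pi A y -> y < n -> R src = addr slot y ->
  stack stk A slot R M -> size stk < 10 * r ->
  ok (walk f src dst) (fun R' M' => exists stk', [/\ stack stk' A slot R' M',
      {subset stk <= stk'} /\ size stk' <= (size stk).+1,
      forall i, i \notin [:: 8; 26; 27; 30] -> R' i = R i,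
      forall y, base <= y -> M' y = M y
    & forall s, s < y -> nodes pi A s -> Q s ->
        (forall z, s < z <= y -> ~~ Q z) ->
        (forall z1 z2 z3, s < z1 -> z1 < z2 -> z2 < z3 -> z3 < y ->
           nodes pi A z1 -> nodes pi A z2 -> nodes pi A z3 -> False) ->
        tgt s \in stk']) R M.
Proof.
move=> hf hQ ht hA' Q0 Ny yn Rs hs sz.
have f6 : f < 6 by move: hf; rewrite !inE => /orP [] /eqP [-> _ _].
have srcn : src \notin [:: 26; 27; 30] by move: hf; rewrite !inE => /orP [] /eqP [_ -> _].
have dstn : dst \in [:: 26; 27] by move: hf; rewrite !inE => /orP [] /eqP [_ _ ->].
rewrite /walk; exec => //.
apply: (ok_seq (back_ok f6 hQ Q0 Ny _)); first by regs.
move=> R1 M1 [-> f1 [y1 [R1y N1 l1 b1]]].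
apply: (ok_seq (back_ok f6 hQ Q0 N1 R1y)) => R2 M2 [-> f2 [y2 [R2y N2 l2 b2]]].
apply: (ok_seq (back_ok f6 hQ Q0 N2 R2y)) => R3 M3 [-> f3 [y3 [R3y N3 l3 b3]]].
exec; first by rewrite R3y; apply: addr_lt.
have fr i : i \notin [:: 26; 27; 30] -> R3 i = R i.
  by move=> hi; rewrite f3 // f2 // f1 // (upd_notin _ _ hi).
have fr' i : i \notin [:: 8; 26; 27; 30] -> i \notin [:: 26; 27; 30].
  by rewrite !inE !negb_or => /and4P [_ -> -> ->].
have res s : s < y -> nodes pi A s -> Q s ->
    (forall z, s < z <= y -> ~~ Q z) ->
    (forall z1 z2 z3, s < z1 -> z1 < z2 -> z2 < z3 -> z3 < y ->
       nodes pi A z1 -> nodes pi A z2 -> nodes pi A z3 -> False) -> y3 = s.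
  by move=> sy Ns Qs nQ nz; apply: (back_step_to sy Ns Qs nQ nz N1 N2 N3).
apply: ok_if; rewrite /cond_eval /cond_regs; regs; rewrite R3y hQ // => c1.
  apply: ok_skip; exists stk; split=> //.
  - case: hs => h1 h2 h3; split=> //; regs; by rewrite fr.
  - by split.
  - by move=> i hi; rewrite !(upd_notin _ _ hi) // fr // fr'.
  - by move=> s sy Ns Qs nQ nz; rewrite (res s sy Ns Qs nQ nz) Qs in c1.
rewrite negbK in c1.
have [At tn] := hA' y3 c1 ltac:(lia).
have hs' : stack stk A slot (upd (upd (upd (upd R3 30 f) 30 (addr slot y3 + f)) 27
    (M (addr slot y3 + f))) 30 0) M.
  by case: hs => h1 h2 h3; split=> //; regs; rewrite fr.
have hd : dst \in [:: 24; 26; 27] by rewrite inE dstn orbT.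
apply: (ok_weak _ _ (push_ok (c := tgt y3) hd _ hs' At tn sz)) => //.
- move=> R' M' [h1 h2 h3]; exists (rcons stk (tgt y3)); split=> //.
  + split; last by rewrite size_rcons.
    by move=> z hz; rewrite mem_rcons inE hz orbT.
  + move=> i hi; rewrite h2.
      by rewrite !(upd_notin _ _ hi) // fr // fr'.
    by move: hi; rewrite !inE !negb_or => /and4P [-> _ _ ->].
  + by move=> s sy Ns Qs nQ nz; rewrite -(res s sy Ns Qs nQ nz) mem_rcons inE eqxx.
- move: dstn (ht y3 N3 c1); rewrite !inE => /orP [] /eqP ->; regs => <- //=.
Qed.

Lemma insert_ok x R u v y : x \in [:: 24; 25] ->
  nodes pi A u -> is_next (nodes pi A) u v ->
  R x = addr slot v -> R 26 = y -> R 28 = 0 -> R 14 = base + 6 * c -> c < 5 * r ->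
  ok (insert_before x) (fun R' M' => [/\
      M' = insert_mem M (base + 6 * c) y (addr slot u) (addr slot v),
      R' x = base + 6 * c, R' 14 = base + 6 * c.+1
    & forall i, i \notin [:: x; 14; 27; 30] -> R' i = R i]) R M.
Proof.
move=> hx Nu nx Rx R26 R28 R14 c5; have [_ Nv _] := nx.
have lu := addr_lt Nu; have lv := addr_lt Nv.
move: hx Rx; rewrite !inE => /orP [] /eqP -> Rx.
all: exec; first by rewrite Rx; apply: lv.
all: rewrite Rx (rep_prv hr Nu nx).
all: do 5 (exec; first by rewrite R14; lia).
all: exec; first by apply: lu.
all: exec; first by rewrite Rx; apply: lv.
all: exec; first by [].
all: exec; first by rewrite R14; lia.
all: apply: ok_skip; rewrite R14 R26 R28 Rx; split=> //; last by frame.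
all: regs; lia.
Qed.

End Body.

Lemma insert_mem_below m q y u v x :
  base <= q -> base <= u -> base <= v -> x < base -> insert_mem m q y u v x = m x.
Proof. by move=> *; rewrite /insert_mem !upd_diff //; lia. Qed.

Lemma base_le s x : base <= addr s x.
Proof. exact: leq_addr. Qed.

Lemma place_ok A slot M R a o1 o2 u v :
  breakpoints pi A -> rep (nodes pi A) A slot (cnt A) M -> A a -> a < n ->
  cursor pi A a o1 u v ->
  o2 = minn (u - a) (v - hat pi a) ->
  offset pi A a o2 -> cnt (cut A a o2) <= 5 * r ->
  R 17 = a -> R 18 = hat pi a -> R 24 = addr slot u -> R 25 = addr slot v ->
  R 14 = base + 6 * cnt A ->
  ok place (fun R' M' => exists slot',
    [/\ rep (nodes pi (cut A a o2)) A slot' (cnt (cut A a o2)) M',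
        forall x, nodes pi A x -> slot' x = slot x,
        [/\ R' 24 = addr slot' (a + o2), R' 25 = addr slot' (hat pi a + o2)
          & R' 14 = base + 6 * cnt (cut A a o2)],
        forall i, i \notin [:: 14; 21; 22; 24; 25; 26; 27; 28; 30] -> R' i = R i
      & forall x, x < base -> M' x = M x]) R M.
Proof.
move=> hA hr Aa an cu eo2 D2 le5 R17 R18 R24 R25 R14.
have [l1 l2 l3 l4] := cursor_le hA cu.
have [g0 [_ Nu nu] [_ Nv nv]] := cu.
have o12 : o1 < o2 by lia.
have le5' : cnt A <= 5 * r.
  apply: leq_trans le5; apply: sub_count => x h.
  by rewrite (nodes_cut hA an D2) h.
have AN x : A x -> nodes pi A (hat pi x) && nodes pi A x.
  by move=> Ax; rewrite /nodes outs_hat Ax orbT.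
have N0 : nodes pi A 0 by rewrite /nodes (bp_0 hA n0).
rewrite /place.
exec; first by rewrite R24; apply: (addr_lt hr le5' Nu).
rewrite R24 (rep_pos hr Nu).
exec; first by rewrite R17; lia.
rewrite R17.
exec; first by rewrite R25; apply: (addr_lt hr le5' Nv).
rewrite R25 (rep_pos hr Nv).
exec; first by rewrite R18; lia.
rewrite R18; exec; first lia.
have [pn xn] := offset_lt hA an D2.
have ins y z (new : nat) :
    nodes pi A z -> is_next (nodes pi A) y z -> nodes pi A y -> y < new < z -> new <= n ->
    (forall x, nodes pi (cut A a o2) x = nodes pi A x || (x == new)) ->
    cnt (cut A a o2) = (cnt A).+1 /\
    rep (nodes pi (cut A a o2)) A (upd slot new (cnt A)) (cnt A).+1
      (insert_mem M (base + 6 * cnt A) new (addr slot y) (addr slot z)).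
  move=> Nz nyz Ny hn len e; have [_ _ ny] := nyz.
  have Nnew := ny _ hn; split.
    by rewrite (eq_count e) count_add1.
  have /norP [nA nO] : ~~ (A new || outs pi A new) := Nnew.
  by apply: rep_eq (rep_insert hr Ny nyz hn nA nO AN) => // x; rewrite e.
apply: ok_if; rewrite /cond_eval /cond_regs; regs => c1.
  have e2 : o2 = v - hat pi a by lia.
  have ex : hat pi a + o2 = v by lia.
  exec; first by rewrite R17; lia.
  have [y Ny nyu] := prev_exists (x := u) ltac:(lia) N0 Nu.
  have yo : y <= a + o1.
    rewrite leqNgt; apply/negP => h; have [yu _ _] := nyu.
    by have := nu y; rewrite Ny => /(_ ltac:(lia)).
  have [|ec rp] := ins y u (a + o2) Nu nyu Ny ltac:(lia) ltac:(lia).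
    move=> x; rewrite (nodes_cut hA an D2) ex; case: (eqVneq x v) => [->|_].
      by rewrite Nv.
    by rewrite orbF.
  apply: (ok_weak _ _ (insert_ok hr le5' (x := 24) (y := a + o2) _ Ny nyu _ _ _ _ _)) => //.
  - move=> R' M' [-> h1 h2 h3]; exists (upd slot (a + o2) (cnt A)).
    have npv : v != a + o2.
      by apply: contraTneq Nv => ->; apply: nu; lia.
    rewrite ec; split=> //.
    + by move=> x Nx; rewrite upd_diff //; apply: contraTneq Nx => ->; apply: nu; lia.
    + split=> //; first by rewrite h1 /node_addr upd_same.
      by rewrite h3 //; regs; rewrite R25 ex /node_addr upd_diff.
    + move=> i hi; rewrite h3; first by rewrite !(upd_notin _ _ hi).
      by apply: notin_sub hi.
    + by move=> x hx; rewrite insert_mem_below ?base_le ?leq_addr.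
  - by regs; rewrite e2 R17.
  - lia.
apply: ok_if; rewrite /cond_eval /cond_regs; regs => c2.
  have e2 : o2 = u - a by lia.
  have ep : a + o2 = u by lia.
  exec; first by rewrite R18; lia.
  have [y Ny nyv] := prev_exists (x := v) ltac:(lia) N0 Nv.
  have yo : y <= hat pi a + o1.
    rewrite leqNgt; apply/negP => h; have [yu _ _] := nyv.
    by have := nv y; rewrite Ny => /(_ ltac:(lia)).
  have [|ec rp] := ins y v (hat pi a + o2) Nv nyv Ny ltac:(lia) ltac:(lia).
    move=> x; rewrite (nodes_cut hA an D2) ep; case: (eqVneq x u) => [->|_] //.
    by rewrite Nu.
  apply: (ok_weak _ _ (insert_ok hr le5' (x := 25) (y := hat pi a + o2) _ Ny nyv _ _ _ _ _)) => //.
  - move=> R' M' [-> h1 h2 h3]; exists (upd slot (hat pi a + o2) (cnt A)).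
    have npv : u != hat pi a + o2.
      by apply: contraTneq Nu => ->; apply: nv; lia.
    rewrite ec; split=> //.
    + by move=> x Nx; rewrite upd_diff //; apply: contraTneq Nx => ->; apply: nv; lia.
    + split=> //; last by rewrite h1 /node_addr upd_same.
      by rewrite h3 //; regs; rewrite R24 ep /node_addr upd_diff.
    + move=> i hi; rewrite h3; first by rewrite !(upd_notin _ _ hi).
      by apply: notin_sub hi.
    + by move=> x hx; rewrite insert_mem_below ?base_le ?leq_addr.
  - by regs; rewrite e2 R18.
  - lia.
have ep : a + o2 = u by lia.
have ex : hat pi a + o2 = v by lia.
have e x : nodes pi (cut A a o2) x = nodes pi A x.
  rewrite (nodes_cut hA an D2) ep ex; case: (eqVneq x u) => [->|_]; first by rewrite Nu.
  by case: (eqVneq x v) => [->|_]; rewrite ?Nv ?orbF.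
apply: ok_skip; exists slot; rewrite (eq_count e) ep ex; split=> //; last by frame.
by apply: rep_eq hr => // x; rewrite e.
Qed.

Definition heap (A : pred nat) (slot R M : nat -> nat) : Prop :=
  [/\ breakpoints pi A, well_charged pi A,
      cnt A <= count A (iota 0 n.+1) + r,
      rep (nodes pi A) A slot (cnt A) M & R 14 = base + 6 * cnt A].

Definition main_inv (k : nat) (R M : nat -> nat) : Prop :=
  exists A slot stk,
  [/\ [/\ R 0 = r, R 4 = n & R 9 = 10 * r], heap A slot R M, stack stk A slot R M,
      forall c, A c -> c < n -> crowded pi A c -> c \in stk
    & size stk + 3 * ((3 * r).+1 - count A (iota 0 n.+1)) <= k <= 7 * r].

Lemma cnt_cut A a o : breakpoints pi A -> a < n -> offset pi A a o ->
  cnt (cut A a o) <= (cnt A).+1.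
Proof.
move=> hA an D; have [pn xn] := offset_lt hA an D.
have key new : new <= n -> (forall x, nodes pi (cut A a o) x -> nodes pi A x || (x == new)) ->
    cnt (cut A a o) <= (cnt A).+1.
  move=> hn hs; case: (boolP (nodes pi A new)) => Nn.
    apply: leqW; apply: sub_count => x /hs /orP [//|/eqP -> //].
  by rewrite -(count_add1 Nn hn); apply: sub_count => x /hs.
case/orP: (cut_old D) => h.
- apply: (key (hat pi a + o)); first lia.
  move=> x; rewrite (nodes_cut hA an D); case: (eqVneq x (a + o)) => [->|_] //.
  by rewrite h.
- apply: (key (a + o)); first lia.
  move=> x; rewrite (nodes_cut hA an D); case: (eqVneq x (hat pi a + o)) => [->|_].
    by rewrite h.
  by rewrite orbF.
Qed.

Lemma split_ok A slot M R a o1 o2 o3 u v stk k :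
  heap A slot R M -> stack stk A slot R M -> A a -> a < n ->
  cursor pi A a o1 u v ->
  o2 = minn (u - a) (v - hat pi a) ->
  offset pi A a o1 -> offset pi A a o2 -> offset pi A a o3 -> o1 < o2 -> o2 < o3 ->
  (forall o, offset pi A a o -> o < o2 -> o = o1) ->
  (forall c, A c -> c < n -> crowded pi A c -> c = a \/ c \in stk) ->
  [/\ R 0 = r, R 4 = n & R 9 = 10 * r] ->
  size stk + 3 * ((3 * r).+1 - count A (iota 0 n.+1)) < k <= 7 * r ->
  R 17 = a -> R 18 = hat pi a -> R 24 = addr slot u -> R 25 = addr slot v ->
  ok split_interval (fun R' M' => exists2 k', k' < k & main_inv k' R' M') R M.
Proof.
move=> [hA wc le hr R14] hs Aa an cu eo2 D1 D2 D3 l12 l23 sec cr [R0 R4 R9] hk R17 R18 R24 R25.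
have hA' := breakpoints_cut hA an D2.
have wc' := well_charged_cut hA Aa an D1 D2 D3 l12 l23 wc.
have cA' := count_cut hA Aa an D2 l12 l23.
have le' : cnt (cut A a o2) <= count (cut A a o2) (iota 0 n.+1) + r.
  by rewrite cA' addSn; apply: leq_trans (cnt_cut hA an D2) _.
have cb := count_breakpoints hA' wc' le'.
have le5 : cnt (cut A a o2) <= 5 * r.
  by apply: (leq_trans le'); apply: (leq_trans (leq_add cb (leqnn r))); lia.
rewrite cA' in cb.
have [pn xn] := offset_lt hA an D2.
have hp := hat_cut hA an D2.
have Ap : cut A a o2 (a + o2) by rewrite /cut eqxx orbT.
have Np : nodes pi (cut A a o2) (a + o2) by rewrite /nodes Ap.
have Nx : nodes pi (cut A a o2) (hat pi (a + o2)) by rewrite /nodes outs_hat Ap orbT.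
rewrite /split_interval.
apply: (ok_seq (place_ok hA hr Aa an cu eo2 D2 le5 R17 R18 R24 R25 R14)).
move=> R1 M1 [slot1 [rp1 sl1 [r24 r25 r14] f1 m1]].
exec; first by rewrite r24 /node_addr; have := leq_trans (rep_lt rp1 Np) le5; clear; lia.
rewrite r24 r25.
exec.
  by rewrite r25; have := leq_trans (rep_lt rp1 Nx) le5; rewrite hp /node_addr; clear; lia.
rewrite r24 r25.
have ax x : cut A a o2 x -> x < n -> x = a + o2 \/ A x.
  by rewrite /cut => /orP [->|/eqP ->]; [right | left].
match goal with |- okT _ _ _ _ _ ?X ?Y => set R2 := X; set M2 := Y end.
have rp2 : rep (nodes pi (cut A a o2)) (cut A a o2) slot1 (cnt (cut A a o2)) M2.
  by have := rep_link rp1 Np Nx; rewrite hp.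
have f2 i : i \notin [:: 14; 21; 22; 24; 25; 26; 27; 28; 30] -> R2 i = R i.
  by move=> hi; rewrite /R2 !(upd_notin _ _ hi) // f1.
have hs2 : stack stk (cut A a o2) slot1 R2 M2.
  case: hs => h1 h2 h3; split.
  - by rewrite f2.
  - move=> i hi; rewrite /M2 !upd_diff; last 2 first.
    + by rewrite /node_addr; lia.
    + by rewrite /node_addr; lia.
    rewrite m1; last by lia.
    rewrite h2 //; congr (_ + 6 * _); rewrite sl1 //.
    by rewrite /nodes (h3 _ (mem_nth 0 hi)).1.
  - by move=> c /h3 [h4 h5]; rewrite /cut h4.
have sz : size stk + 3 < 7 * r by move: hk cb; lia.
apply: (ok_seq (push_ok (x := 24) isT r24 hs2 Ap pn _)); first by lia.
move=> R3 M3 [hs3 f3 m3].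
have rp3 := rep_frame m3 rp2.
have N0 : cut A a o2 0 by apply: (bp_0 hA' n0).
have Q0 : outs pi (cut A a o2) 0 by apply: (outs_0 hA' n0).
have nz x : addr slot1 x == 0 = false by apply/negbTE/addr_gt0.
have sz3 : size (rcons stk (a + o2)) < 10 * r by rewrite size_rcons; lia.
apply: (ok_seq (walk_ok hA' rp3 le5 (f := 4) (src := 24) (dst := 27)
   (Q := outs pi (cut A a o2)) (tgt := hat pi^-1) isT _ _ _ Q0 Np pn _ hs3 sz3)).
- by move=> x /(rep_pre rp3) ->; case: ifP => // _; rewrite nz.
- by move=> x /(rep_pre rp3) /= -> ->.
- by move=> x h1 h2; rewrite hat_lt.
- by rewrite f3 // r24.
move=> R4' M4 [stk4 [hs4 [sub4 sz4] f4 m4 w4]].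
have rp4 := rep_frame m4 rp3.
rewrite size_rcons in sz4.
have sz4' : size stk4 < 10 * r by lia.
rewrite hp in Nx.
apply: (ok_weak _ _ (walk_ok hA' rp4 le5 (f := 3) (src := 25) (dst := 26)
   (Q := cut A a o2) (tgt := id) isT _ _ _ N0 Nx xn _ hs4 sz4')) => //; last first.
- by rewrite f4 // f3 // r25.
- by move=> x /(rep_img rp4) ->; case: ifP => // _; rewrite nz.
move=> R5 M5 [stk5 [hs5 [sub5 sz5] f5 m5 w5]].
have rp5 := rep_frame m5 rp4.
have fr i : i \notin [:: 8; 14; 21; 22; 24; 25; 26; 27; 28; 30] -> R5 i = R i.
  by move=> hi; rewrite f5 ?f4 ?f3 ?f2 //; apply: notin_sub hi.
exists k.-1; first by lia.
exists (cut A a o2), slot1, stk5; split=> //.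
- by rewrite !fr.
- by split=> //; rewrite f5 // f4 // f3 // r14.
- move=> c Ac cn cc.
  have [->|[ca Ac' h]] := crowded_cut hA Aa an D2 l12 l23 sec Ac cc.
    by apply: sub5; apply: sub4; rewrite mem_rcons mem_head.
  case: (boolP (c \in stk)) => cstk.
    by apply: sub5; apply: sub4; rewrite mem_rcons inE cstk orbT.
  have ncr : ~ crowded pi A c.
    by move=> /(cr c Ac' cn) [/eqP|]; [rewrite (negbTE ca) | rewrite (negbTE cstk)].
  case: h => [//|[np [o Do eo]]|[nx [o Do eo]]].
  + have [q1 q2 q3] := crowded_cut_out hA Aa an D2 l12 l23 Ac ncr np Do eo.
    apply: sub5; rewrite -[c](hatK pi); apply: w4 => //; last by rewrite outs_hat.
    by rewrite /nodes outs_hat Ac orbT.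
  + have [q1 q2 q3] := crowded_cut_in hA Aa an D2 l12 l23 Ac ncr nx Do eo.
    by apply: w5 => //; rewrite /nodes Ac.
- by rewrite cA'; move: hk cb; lia.
Qed.

Lemma heap_le A slot R M : heap A slot R M -> cnt A <= 5 * r.
Proof.
move=> [hA wc le _ _]; apply: (leq_trans le).
by apply: (leq_trans (leq_add (count_breakpoints hA wc le) (leqnn r))); clear -r0; lia.
Qed.

Lemma main_body_ok k R M : main_inv k R M -> R 9 < R 8 ->
  ok main_body (fun R' M' => exists2 k', k' < k & main_inv k' R' M') R M.
Proof.
move=> [A [slot [stk [[R0 R4 R9] hh hs cr hk]]]] ne.
have le5 := heap_le hh.
have [hA wc le hr R14] := hh; have [R8 hM hst] := hs.
case/lastP: stk hs cr hk R8 hM hst => [|stk a] hs cr hk R8 hM hst.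
  by move: ne; rewrite R9 R8 addn0 ltnn.
rewrite size_rcons in R8 hk hM.
have [Aa an] : A a /\ a < n by apply: hst; rewrite mem_rcons mem_head.
have Ma : M (10 * r + size stk + 0) = addr slot a.
  by rewrite addn0 hM // nth_rcons ltnn eqxx.
have Na : nodes pi A a by rewrite /nodes Aa.
have Nb : nodes pi A (hat pi a) by rewrite /nodes outs_hat Aa orbT.
have Nn : nodes pi A n by rewrite /nodes (bp_n hA).
have bn : hat pi a < n by rewrite hat_lt.
have [nu _] := nextpP an Nn; have [nv _] := nextpP bn Nn.
set u := nextp _ _ a in nu; set v := nextp _ _ (hat pi a) in nv.
have cu : cursor pi A a 0 u v by split; rewrite ?addn0 // => y; lia.
have sz : size stk < 7 * r by move: hk; clear; lia.
have la k' : k' < 6 -> addr slot a + k' < S by apply: (addr_lt hr le5 Na).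
have lb k' : k' < 6 -> addr slot (hat pi a) + k' < S by apply: (addr_lt hr le5 Nb).
rewrite /main_body.
exec; first by clear -S_le r0; lia.
exec; first by rewrite R8; clear -S_le sz; lia.
have -> : R 8 - 1 = 10 * r + size stk by rewrite R8; clear; lia.
exec; first by clear -sz; lia.
rewrite Ma.
exec; first by apply: la.
rewrite (rep_img hr Na) Aa.
exec; first by apply: la.
rewrite (rep_pos hr Na).
exec; first by apply: lb.
rewrite (rep_pos hr Nb).
exec; first by apply: la.
rewrite (rep_nxt hr Na nu).
exec; first by apply: lb.
rewrite (rep_nxt hr Nb nv).
match goal with |- okT _ _ _ _ _ ?X _ => set R1 := X end.
have f1 i : i \notin [:: 8; 15; 16; 17; 18; 19; 20; 21; 30] -> R1 i = R i.
  by move=> hi; rewrite /R1 !(upd_notin _ _ hi).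
have R1_8 : R1 8 = 10 * r + size stk by [].
have R1_17 : R1 17 = a by [].
have R1_18 : R1 18 = hat pi a by [].
have R1_19 : R1 19 = addr slot u by [].
have R1_20 : R1 20 = addr slot v by [].
clearbody R1.
have small : ~ crowded pi A a -> forall R', R' 8 = 10 * r + size stk ->
    (forall i, i \in [:: 0; 4; 9; 14] -> R' i = R i) ->
    exists2 k', k' < k & main_inv k' R' M.
  move=> nc R' h8 hf; exists k.-1; first by move: hk; clear; lia.
  exists A, slot, stk; split; rewrite ?hf //.
  - by split=> //; rewrite hf.
  - split=> //.
    + by move=> i hi; rewrite hM ?nth_rcons ?hi // ltnW.
    + by move=> c hc; apply: hst; rewrite mem_rcons inE hc orbT.
  - by move=> c Ac cn cc; have := cr c Ac cn cc; rewrite mem_rcons inE => /orP [/eqP e|//];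
      case: nc; rewrite -e.
  - by move: hk; clear; lia.
have hs' R' : R' 8 = 10 * r + size stk -> stack stk A slot R' M.
  move=> h8; split=> //.
  + by move=> i hi; rewrite hM ?nth_rcons ?hi // ltnW.
  + by move=> c hc; apply: hst; rewrite mem_rcons inE hc orbT.
have advance_end o x y R' : cursor pi A a o x y -> A x -> x - a = y - hat pi a ->
    R' 17 = a -> R' 18 = hat pi a -> R' 19 = addr slot x -> R' 20 = addr slot y ->
    ok advance (fun R2 M2 => [/\ M2 = M,
      forall i, i \notin [:: 19; 20; 21; 22; 23; 26; 30] -> R2 i = R' i, R2 26 = 0
    & R2 19 = addr slot x /\ R2 20 = addr slot y]) R' M.
  move=> cu' Ax e r17 r18 r19 r20.
  apply: ok_weak (advance_ok hA hr le5 Aa an cu' r17 r18 r19 r20) => //.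
  move=> R2 M2 [-> f [[h26 h19 h20 _ _]|[_ h _]]]; last by rewrite Ax e eqxx in h.
  by rewrite h19 h20 r19 r20.
apply: (ok_seq (advance_ok hA hr le5 Aa an cu R1_17 R1_18 R1_19 R1_20)).
move=> R2 M2 [-> f2 C2].
exec => //; exec => //.
match goal with |- okT _ _ _ _ _ ?X _ => set R3 := X end.
have f3 i : i \notin [:: 19; 20; 21; 22; 23; 24; 25; 26; 30] -> R3 i = R1 i.
  by move=> hi; rewrite /R3 !(upd_notin _ _ hi) // f2 //; apply: notin_sub hi.
have R3_19 : R3 19 = R2 19 by [].
have R3_20 : R3 20 = R2 20 by [].
have R3_24 : R3 24 = R2 19 by [].
have R3_25 : R3 25 = R2 20 by [].
clearbody R3.
have R3_17 : R3 17 = a by rewrite f3.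
have R3_18 : R3 18 = hat pi a by rewrite f3.
case: C2 => [[_ h19 h20 Au eu]|[_ neu [u1 [v1 [cu1 h19 h20]]]]].
  have all0 := cursor_end hA an cu eu Au.
  have nc : ~ crowded pi A a.
    move=> [o1 [o2 [o3 [[p1 _ _] D2 _ l1 _]]]]; have := all0 _ D2.
    by clear -p1 l1; lia.
  rewrite h19 R1_19 in R3_19; rewrite h20 R1_20 in R3_20.
  apply: (ok_seq (advance_end _ _ _ _ cu Au eu R3_17 R3_18 R3_19 R3_20)).
  move=> R5 M5 [-> f5 h26 [g19 g20]].
  have R5_17 : R5 17 = a by rewrite f5.
  have R5_18 : R5 18 = hat pi a by rewrite f5.
  apply: (ok_seq (advance_end _ _ _ _ cu Au eu R5_17 R5_18 g19 g20)).
  move=> R6 M6 [-> f6 g26 _].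
  apply: ok_if; rewrite /cond_eval /cond_regs g26 // => _.
  apply: ok_skip; apply: small => //.
    by regs; rewrite f6 // f5 // f3.
  by move=> i; rewrite !inE => /or4P [] /eqP ->; regs; rewrite f6 // f5 // f3 // f1.
have [l01 D1 m1] := cursor_next hA an cu neu.
set e1 := minn _ _ in cu1 l01 D1 m1.
rewrite h19 in R3_19 R3_24; rewrite h20 in R3_20 R3_25.
apply: (ok_seq (advance_ok hA hr le5 Aa an cu1 R3_17 R3_18 R3_19 R3_20)).
move=> R5 M5 [-> f5 [[_ g19 g20 Au eu]|[_ neu1 [u2 [v2 [cu2 g19 g20]]]]]].
  have all1 := cursor_end hA an cu1 eu Au.
  have nc : ~ crowded pi A a.
    move=> [o1 [o2 [o3 [[p1 g1 N1] D2 _ l1 _]]]]; have := all1 _ D2.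
    have := m1 o1 (And3 p1 g1 N1) p1.
    by clear -p1 l1; lia.
  rewrite R3_19 in g19; rewrite R3_20 in g20.
  have R5_17 : R5 17 = a by rewrite f5.
  have R5_18 : R5 18 = hat pi a by rewrite f5.
  apply: (ok_seq (advance_end _ _ _ _ cu1 Au eu R5_17 R5_18 g19 g20)).
  move=> R6 M6 [-> f6 g26 _].
  apply: ok_if; rewrite /cond_eval /cond_regs g26 // => _.
  apply: ok_skip; apply: small => //.
    by regs; rewrite f6 // f5 // f3.
  by move=> i; rewrite !inE => /or4P [] /eqP ->; regs; rewrite f6 // f5 // f3 // f1.
have [l12 D2 m2] := cursor_next hA an cu1 neu1.
set e2 := minn _ _ in cu2 l12 D2 m2.
have R5_17 : R5 17 = a by rewrite f5.
have R5_18 : R5 18 = hat pi a by rewrite f5.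
apply: (ok_seq (advance_ok hA hr le5 Aa an cu2 R5_17 R5_18 g19 g20)).
move=> R6 M6 [-> f6 [[g26 _ _ Au eu]|[g26 neu2 _]]].
  have all2 := cursor_end hA an cu2 eu Au.
  have nc : ~ crowded pi A a.
    move=> [o1 [o2 [o3 [[p1 g1 N1] F2 F3 q1 q2]]]]; have h3 := all2 _ F3.
    have h1 := m1 o1 (And3 p1 g1 N1) p1; have h2 := m2 o2 F2.
    by have := h2 ltac:(clear -q1 h1; lia); clear -q2 h3; lia.
  apply: ok_if; rewrite /cond_eval /cond_regs g26 // => _.
  apply: ok_skip; apply: small => //.
    by regs; rewrite f6 // f5 // f3.
  by move=> i; rewrite !inE => /or4P [] /eqP ->; regs; rewrite f6 // f5 // f3 // f1.
have [l23 D3 m3] := cursor_next hA an cu2 neu2.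
set e3 := minn _ _ in l23 D3 m3.
apply: ok_if; rewrite /cond_eval /cond_regs g26 // => _.
apply: (split_ok (slot := slot) (u := u1) (v := v1) (stk := stk)
  (o2 := e2) _ _ Aa an cu1 _ D1 D2 D3 l12 l23) => //; regs.
- by split=> //; regs; rewrite f6 // f5 // f3 // f1.
- by apply: hs'; regs; rewrite f6 // f5 // f3.
- move=> o [p g N] lt; have h1 := m1 o (And3 p g N) p.
  have [//|l] : o = e1 \/ e1 < o by clear -h1; lia.
  by have := m2 o (And3 p g N) l; clear -lt; lia.
- move=> c Ac cn cc; have := cr c Ac cn cc.
  by rewrite mem_rcons inE => /orP [/eqP ->|->]; [left|right].
- by split; regs; rewrite f6 // f5 // f3 // f1.
- by rewrite f6 // R5_17.
- by rewrite f6 // R5_18.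
- by rewrite f6 // f5.
- by rewrite f6 // f5.
Qed.

Lemma main_loop_ok k R M : main_inv k R M ->
  okT w S (While (CLt 9 8) main_body) (k.+1 * csize (While (CLt 9 8) main_body))
    (fun R' M' => exists A slot,
      [/\ R' 0 = r, R' 4 = n, heap A slot R' M'
        & forall c, A c -> c < n -> ~ crowded pi A c]) R M.
Proof.
move=> hi.
apply: (ok_weak _ _ (okT_while (I := main_inv) _ hi)) => //; last first.
  by move=> k' R' M' hi' /= lt; apply: main_body_ok.
move=> R' M' [k' [R0 [[A [slot [stk [[h0 h4 h9] hh hs cr hk]]]] /= nlt ->]]].
exists A, slot; split=> // c Ac cn cc.
have := cr c Ac cn cc; case: hs => h8 _ _; move: nlt; rewrite h8 h9 -leqNgt.
by case: stk {h8 cr hk} => // x s; clear; move=> /=; lia.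
Qed.

Section Output.

Variables (A : pred nat) (slot : nat -> nat).
Hypotheses (hA : breakpoints pi A) (le5 : cnt A <= 5 * r).
Hypothesis (le3 : size (elems A n) <= 3 * r).

Definition out_regs (R : nat -> nat) : Prop :=
  [/\ R 4 = n, [/\ R 10 = 20 * r, R 11 = 24 * r & R 12 = 28 * r], R 13 = base & R 21 = 1].

Definition at_node (x k : nat) (R M : nat -> nat) : Prop :=
  [/\ rep (nodes pi A) A slot (cnt A) M, nodes pi A x,
      [/\ R 15 = addr slot x, R 16 = size (elems A x) & R 22 = x]
    & count (nodes pi A) (iota x (n.+1 - x)) <= k].

Lemma count_node x y : nodes pi A x -> x < y -> y <= n.+1 ->
  count (nodes pi A) (iota y (n.+1 - y)) < count (nodes pi A) (iota x (n.+1 - x)).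
Proof.
move=> Nx xy yn; rewrite (_ : n.+1 - x = (y - x.+1 + (n.+1 - y)).+1); last by lia.
rewrite /= Nx iotaD count_cat (_ : x.+1 + (y - x.+1) = y); last by lia.
by rewrite add1n ltnS leq_addl.
Qed.

Lemma size_elems_le x : x <= n -> size (elems A x) <= 3 * r.
Proof.
move=> xn; apply: leq_trans le3.
by rewrite (elems_catE A xn) size_cat leq_addr.
Qed.

Lemma at_node_next x : nodes pi A x -> x < n -> exists y,
  [/\ is_next (nodes pi A) x y, y <= n & elems A y = elems A x.+1].
Proof.
move=> Nx xn; have Nn : nodes pi A n by rewrite /nodes (bp_n hA).
have [h1 h2] := nextpP xn Nn; exists (nextp (nodes pi A) n x); split=> //.
case: h1 => l1 _ h; apply: elems_gap => // z /h.
by rewrite /nodes negb_or => /andP [].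
Qed.

Definition ranks_below (x : nat) (M : nat -> nat) : Prop :=
  forall y, nodes pi A y -> y < x -> M (addr slot y + 5) = rank_of A y.

Definition rank_inv k R M := exists x,
  [/\ x <= n, out_regs R, at_node x k R M & ranks_below x M].

Lemma rank_body_ok k R M : rank_inv k R M -> R 22 < R 4 ->
  ok rank_body (fun R' M' => exists2 k', k' < k & rank_inv k' R' M') R M.
Proof.
move=> [x [xn [R4 [R10 R11 R12] R13 R21] [hr Nx [R15 R16 R22] hk] hrk]] lt.
rewrite R22 R4 in lt.
have [y [nxy yn ey]] := at_node_next Nx lt; have [xy Ny _] := nxy.
have lx k' : k' < 6 -> addr slot x + k' < S by apply: (addr_lt hr le5 Nx).
have ly k' : k' < 6 -> addr slot y + k' < S by apply: (addr_lt hr le5 Ny).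
have A0 : A 0 by apply: (bp_0 hA n0).
have s1 : 0 < size (elems A x.+1).
  have : 0 \in elems A x.+1 by rewrite mem_elems A0.
  by case: (elems A x.+1).
have s2 : size (elems A x.+1) <= 3 * r by apply: size_elems_le.
rewrite /rank_body.
exec; first by rewrite R15; apply: lx.
rewrite R15 (rep_img hr Nx).
apply: (ok_seq (P := fun R' M' => [/\ M' = M, R' 16 = size (elems A x.+1)
   & forall i, i \notin [:: 16; 17; 30] -> R' i = R i])).
  apply: ok_if; rewrite /cond_eval /cond_regs; regs; rewrite elems_rcons; case: (A x) => h.
  - by rewrite (negbTE (addr_gt0 slot (hat pi x))) in h.
  - by apply: ok_skip; split; [|regs|frame].
  - exec; first by rewrite R16; have := size_elems_le xn; clear -S_le r0; lia.
    by apply: ok_skip; split; [|regs; rewrite size_rcons R16 addn1|frame].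
  - by [].
move=> R1 M1 [-> r16 f1].
have r15 : R1 15 = addr slot x by rewrite f1.
have r21 : R1 21 = 1 by rewrite f1.
exec; first by rewrite r21 r16; clear -s1 s2 S_le; lia.
exec; first by rewrite r15; apply: lx.
rewrite r15 r21 r16.
match goal with |- okT _ _ _ _ _ _ ?X => set M2 := X end.
have rp : rep (nodes pi A) A slot (cnt A) M2 by apply: rep_rank.
exec; first by rewrite f1 // R15; apply: lx.
rewrite (f1 15) // R15 (rep_nxt rp Nx nxy).
exec; first by apply: ly.
rewrite (rep_pos rp Ny).
apply: ok_skip; exists k.-1.
  have := count_node Nx xy ltac:(lia); have : 0 < k; last by clear; lia.
  by apply: leq_trans hk; have := count_node Nx xy ltac:(lia); clear; lia.
exists y; split=> //.
- by split; [|split| |]; regs; rewrite f1.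
- split=> //; regs; first by split=> //; rewrite r16 ey.
  by have := leq_trans (count_node Nx xy ltac:(lia)) hk; clear; lia.
move=> z Nz zy; rewrite /M2.
case: (eqVneq z x) => [->|zx].
  by rewrite upd_same /rank_of -size_elems subn1.
rewrite upd_diff; last first.
  by apply: contra zx => /eqP e; apply/eqP/(rep_inj hr) => //; move: e; rewrite /node_addr; lia.
apply: hrk => //; have [_ _ h] := nxy; rewrite ltnNge leq_eqVlt eq_sym (negbTE zx) /=.
by apply/negP => xz; have := h z; rewrite xz zy Nz => /(_ isT).
Qed.

Definition out_inv k R M := exists x,
  [/\ x <= n, out_regs R, at_node x k R M, ranks_below n M
    & [/\ array_at M (20 * r) (elems A x),
          array_at M (24 * r) [seq hat pi i | i <- elems A x]
        & array_at M (28 * r) [seq rank_of A (hat pi i) | i <- elems A x]]].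

Lemma out_body_ok k R M : out_inv k R M -> R 22 < R 4 ->
  ok out_body (fun R' M' => exists2 k', k' < k & out_inv k' R' M') R M.
Proof.
move=> [x [xn [R4 [R10 R11 R12] R13 R21] [hr Nx [R15 R16 R22] hk] hrk [a1 a2 a3]]] lt.
rewrite R22 R4 in lt.
have [y [nxy yn ey]] := at_node_next Nx lt; have [xy Ny _] := nxy.
have lx k' : k' < 6 -> addr slot x + k' < S by apply: (addr_lt hr le5 Nx).
have ly k' : k' < 6 -> addr slot y + k' < S by apply: (addr_lt hr le5 Ny).
have s2 : size (elems A x.+1) <= 3 * r by apply: size_elems_le.
have s1 := size_elems_le xn.
rewrite /out_body.
exec; first by rewrite R15; apply: lx.
rewrite R15 (rep_img hr Nx).
apply: (ok_seq (P := fun R' M' => [/\ forall z, base <= z -> M' z = M z,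
   R' 16 = size (elems A x.+1),
   forall i, i \notin [:: 16; 17; 18; 19; 30] -> R' i = R i
   & [/\ array_at M' (20 * r) (elems A x.+1),
          array_at M' (24 * r) [seq hat pi i | i <- elems A x.+1]
        & array_at M' (28 * r) [seq rank_of A (hat pi i) | i <- elems A x.+1]]])).
  apply: ok_if; rewrite /cond_eval /cond_regs; regs.
    rewrite elems_rcons; case: (A x) => h.
      by rewrite (negbTE (addr_gt0 slot (hat pi x))) in h.
    by apply: ok_skip; split; [|regs|frame|split].
  rewrite elems_rcons; case: (boolP (A x)) => // Ax _; rewrite !map_rcons.
  have Nh : nodes pi A (hat pi x) by rewrite /nodes outs_hat Ax orbT.
  have lh k' : k' < 6 -> addr slot (hat pi x) + k' < S by apply: (addr_lt hr le5 Nh).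
  have hl : base <= addr slot (hat pi x) by exact: leq_addr.
  have := s2; rewrite elems_rcons Ax size_rcons => s3.
  exec; first by rewrite R15; apply: lx.
  rewrite R15 (rep_pos hr Nx).
  exec; first by rewrite R10 R16; clear -s1 S_le r0; lia.
  rewrite R10 R16.
  exec; first by clear -s3; lia.
  exec; first by apply: lh.
  rewrite upd_diff; last by clear -s3 hl; lia.
  rewrite (rep_pos hr Nh).
  exec; first by rewrite R11 R16; clear -s1 S_le r0; lia.
  rewrite R11 R16.
  exec; first by clear -s3; lia.
  exec; first by apply: lh.
  rewrite !upd_diff; last 2 first.
  - by clear -s3 hl; lia.
  - by clear -s3 hl; lia.
  rewrite (hrk _ Nh); last by rewrite hat_lt.
  exec; first by rewrite R12 R16; clear -s1 S_le r0; lia.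
  rewrite R12 R16.
  exec; first by clear -s3; lia.
  exec; first by rewrite R16; clear -s1 S_le r0; lia.
  rewrite R16; apply: ok_skip; split.
  - by move=> z hz; rewrite !upd_diff //; clear -hz s3; lia.
  - by regs; rewrite addn1.
  - by frame.
  split.
  - apply: array_at_upd; first by rewrite size_rcons; clear -s3; lia.
    apply: array_at_upd; first by rewrite size_rcons; clear -s3; lia.
    by apply: array_at_rcons; rewrite ?addn0.
  - apply: array_at_upd; first by rewrite size_rcons size_map; clear -s3; lia.
    apply: array_at_rcons; first by rewrite size_map addn0.
    by apply: array_at_upd => //; clear -s3; lia.
  - apply: array_at_rcons; first by rewrite size_map addn0.
    by do 2 (apply: array_at_upd; first by clear -s3; lia).
move=> R1 M1 [m1 r16 f1 arr].
have rp := rep_frame m1 hr.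
exec; first by rewrite f1 // R15; apply: lx.
rewrite (f1 15) // R15 (rep_nxt rp Nx nxy).
exec; first by apply: ly.
rewrite (rep_pos rp Ny).
apply: ok_skip; exists k.-1.
  have := count_node Nx xy ltac:(lia); have : 0 < k; last by clear; lia.
  by apply: leq_trans hk; have := count_node Nx xy ltac:(lia); clear; lia.
exists y; split=> //.
- by split; [|split| |]; regs; rewrite f1.
- split=> //; regs; first by split=> //; rewrite r16 ey.
  by have := leq_trans (count_node Nx xy ltac:(lia)) hk; clear; lia.
- by move=> z Nz zn; rewrite m1 ?hrk //; apply: leq_trans (leq_addr _ _); exact: leq_addr.
- by rewrite ey.
Qed.

Definition output_time : nat :=
  csize out_init + ((5 * r).+1 * csize (While (CLt 22 4) rank_body) +
  (csize out_reset + ((5 * r).+1 * csize (While (CLt 22 4) out_body) +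
   csize out_end))).

Lemma output_ok R M :
  R 0 = r -> R 4 = n -> rep (nodes pi A) A slot (cnt A) M ->
  okT w S output output_time (fun R' M' =>
    [/\ R' 0 = size (elems A n), [/\ R' 1 = 20 * r, R' 2 = 24 * r & R' 3 = 28 * r],
        array_at M' (20 * r) (rcons (elems A n) n),
        array_at M' (24 * r) [seq hat pi i | i <- elems A n]
      & array_at M' (28 * r) [seq rank_of A (hat pi i) | i <- elems A n]]) R M.
Proof.
move=> R0 R4 hr.
have N0 : nodes pi A 0 by rewrite /nodes (bp_0 hA n0).
have a0 : addr slot 0 = base by rewrite /node_addr (rep_head hr) muln0 addn0.
have l0 : addr slot 0 + 0 < S by apply: (addr_lt hr le5 N0).
have fin x k R1 M1 : x <= n -> at_node x k R1 M1 -> ~~ (R1 22 < n) -> x = n.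
  by move=> xn [_ _ [_ _ ->] _] h; apply/eqP; rewrite eqn_leq xn leqNgt.
apply: okT_seq.
apply: (ok_weak (leqnn _) _ (_ : ok out_init (fun R' M' => rank_inv (5 * r) R' M') R M)).
  move=> R1 M1 inv1; apply: okT_seq.
  apply: (ok_weak (leqnn _) _ (okT_while (I := rank_inv) _ inv1)); last first.
    by move=> k' R' M' hi /= lt; apply: rank_body_ok.
  move=> R2 M2 [k2 [R2' [[x [xn [r4 r10 r13 r21] hn hrk]] /= nlt ->]]].
  rewrite r4 in nlt; have ex := fin _ _ _ _ xn hn nlt; rewrite ex in hrk hn; case: hn => rp _ _ _.
  apply: okT_seq.
  apply: (ok_weak (leqnn _) _ (_ : ok out_reset (fun R' M' => out_inv (5 * r) R' M') R2' M2)).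
    move=> R3 M3 inv3; apply: okT_seq.
    apply: (ok_weak (leqnn _) _ (okT_while (I := out_inv) _ inv3)); last first.
      by move=> k' R' M' hi /= lt; apply: out_body_ok.
    move=> R5 M5 [k5 [R5' [[y [yn [q4 [q10 q11 q12] q13 q21] hn _ arr]] /= nlt2 ->]]].
    rewrite q4 in nlt2; have ey := fin _ _ _ _ yn hn nlt2; rewrite ey in hn arr.
    case: hn => _ _ [_ q16 _] _; case: arr => a1 a2 a3.
    rewrite /out_end.
    exec; first by rewrite q10 q16; clear -le3 S_le r0; lia.
    rewrite q10 q16.
    exec; first by clear -le3 r0; lia.
    rewrite q4.
    do 4 (exec; first by []).
    rewrite q16 q10 q11 q12; apply: ok_skip; split=> //.
    - by apply: array_at_rcons; rewrite ?addn0.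
    - by apply: array_at_upd => //; rewrite addn0; clear -le3 r0; lia.
    - by apply: array_at_upd => //; rewrite addn0; clear -le3 r0; lia.
  rewrite /out_reset; exec => //; rewrite r13; exec; first by clear -S_le r0; lia.
  rewrite -a0; exec => //.
  rewrite (rep_pos rp N0); apply: ok_skip; exists 0; split.
  - by [].
  - by split.
  - by split=> //; rewrite subn0.
  - exact: hrk.
  - by split.
rewrite /out_init.
do 4 (exec; first by rewrite R0; clear -S_le r0; lia).
rewrite R0; exec; first by clear -S_le r0; lia.
exec => //; exec; first by clear -S_le r0; lia.
have -> : r * 32 = addr slot 0 by rewrite a0 mulnC.
exec => //.
rewrite (rep_pos hr N0); apply: ok_skip; exists 0; split=> //.
- by split=> //; split; regs; rewrite mulnC.
Qed.

End Output.

Notation A0 := (start_pred pi).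
Notation Q0 := (outs pi A0).
Notation N0 := (nodes pi A0).
Notation static := (static pi).
Let startsP := start_breakpoints pi.

Definition slot0 (x : nat) : nat := idx N0 x.

Lemma idxN_le x : x <= n.+1 -> idx N0 x <= 3 * r.
Proof.
move=> xn; apply: leq_trans (idx_mono N0 xn) _; apply: leq_trans (cnt_start pi) _.
by rewrite idxS (bp_n startsP) (idx_starts pi) addn1; clear -r0; lia.
Qed.

Definition base_regs (R : nat -> nat) : Prop :=
  [/\ R 0 = r, R 4 = n, [/\ R 5 = 4 * r, R 6 = 6 * r & R 7 = 8 * r],
      R 8 = 10 * r & R 9 = 10 * r].

Definition sort_inv (k : nat) (R M : nat -> nat) : Prop := exists z,
  [/\ A0 z && (z <= n), base_regs R, R 16 = idx A0 z /\ R 14 = base,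
      static M /\ M (5 * r) = n
    & (forall x, A0 x -> x < z -> M (4 * r + idx Q0 (hat pi x)) = hat pi x) /\
      r - idx A0 z <= k].

Lemma sort_body_ok k R M : sort_inv k R M -> R 16 < R 0 ->
  ok sort_body (fun R' M' => exists2 k', k' < k & sort_inv k' R' M') R M.
Proof.
move=> [z [/andP [Az zn] [R0 R4 [R5 R6 R7] R8 R9] [R16 R14] [st M5] [hq hk]]] lt.
rewrite R16 R0 in lt.
have zlt : z < n.
  rewrite ltn_neqAle zn andbT; apply: contraTneq lt => ->.
  by rewrite idx_starts ltnn.
have il := idxA_lt Az zlt.
have [s1 s2 s3] := st.
have hl : idx Q0 (hat pi z) <= r by apply: idxQ_le; rewrite hat_le.
have hl2 : idx Q0 (hat pi z) < r.
  by rewrite -(idx_outs pi); apply: idx_lt; rewrite ?outs_hat ?hat_lt.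
have [z' [Az' zz' ez' nz']] := first_elem (z := z.+1) zlt (bp_n startsP).
have e1 : idx A0 z + r + 1 = r.+1 + idx A0 z by clear; lia.
have e2 : idx A0 z + r + r + 1 = 2 * r + 1 + idx A0 z by clear; lia.
rewrite /sort_body.
exec; first by rewrite R16 R0; clear -il S_le; lia.
rewrite R16 R0.
exec; first by clear -il; lia.
rewrite e1 s2 //.
exec; first by rewrite R0; clear -il S_le; lia.
rewrite R0.
exec; first by clear -il; lia.
rewrite e2 s3 //.
exec; first by rewrite R5; clear -hl r0 S_le; lia.
rewrite R5.
exec; first by clear -hl r0; lia.
exec; first by rewrite R16; clear -il r0 S_le; lia.
rewrite R16; apply: ok_skip; exists k.-1; first by clear -il hk; lia.
exists z'; split.
- by rewrite Az'; case/andP: zz'.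
- by split=> //; split.
- by regs; rewrite ez' idxS Az addn1.
- split; last by rewrite upd_diff //; clear -hl2; lia.
  by apply: static_frame st => // a ha; rewrite upd_diff //; clear -ha; lia.
split; last by rewrite ez' idxS Az; clear -hk il; lia.
move=> x Ax xz'.
have [xz|->] : x < z \/ x = z.
  have := nz' x; rewrite Ax; clear -xz'; case: (ltngtP x z) => h; [by left| |by right].
  by move=> /(_ ltac:(lia)).
- case: (eqVneq (hat pi x) (hat pi z)) => [->|ne].
    by rewrite [4 * r + _]addnC addn0 upd_same.
  rewrite upd_diff ?hq //; apply: contra ne => /eqP e; apply/eqP.
  have e' : idx Q0 (hat pi x) = idx Q0 (hat pi z) by clear -e; lia.
  case: (ltngtP (hat pi x) (hat pi z)) => // h.
  + by have := idx_lt (A := Q0) _ h; rewrite outs_hat Ax e' ltnn => /(_ isT).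
  + by have := idx_lt (A := Q0) _ h; rewrite outs_hat Az e' ltnn => /(_ isT).
- by rewrite [4 * r + _]addnC addn0 upd_same.
Qed.

Definition sorted_outs (M : nat -> nat) : Prop :=
  forall q, Q0 q -> M (4 * r + idx Q0 q) = q.

Lemma sort_done k R M : sort_inv k R M -> ~~ (R 16 < R 0) ->
  [/\ base_regs R, R 14 = base, static M & sorted_outs M].
Proof.
move=> [z [/andP [Az zn] br [R16 R14] [st M5] [hq _]]].
have [R0 _ _ _ _] := br; rewrite R16 R0 => nlt.
have zE : z = n.
  apply/eqP; rewrite eqn_leq zn leqNgt; apply/negP => h; case/negP: nlt.
  exact: idxA_lt.
split=> // q Qq; have qn : q <= n by apply: (nodes_le startsP); rewrite /nodes Qq orbT.
case: (eqVneq q n) => [->|ne].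
  by rewrite idx_outs (_ : 4 * r + r = 5 * r) //; clear; lia.
have qlt : q < n by rewrite ltn_neqAle ne.
by have := hq (hat pi^-1 q) Qq; rewrite zE hat_lt hatVK; apply.
Qed.

Record merged (z : nat) (M : nat -> nat) : Prop := Merged {
  mg_static : static M;
  mg_outs : sorted_outs M;
  mg_in : forall x, A0 x -> x < z -> M (6 * r + idx A0 x) = addr slot0 x;
  mg_out : forall x, Q0 x -> x < z -> M (8 * r + idx Q0 x) = addr slot0 x;
  mg_node : forall x, N0 x -> x < z ->
    [/\ M (addr slot0 x + 0) = x, M (addr slot0 x + 1) = addr slot0 x + 6,
        M (addr slot0 x + 2) = base + 6 * (slot0 x).-1,
        M (addr slot0 x + 3) = 0 & M (addr slot0 x + 4) = 0] }.

Definition merge_inv (k : nat) (R M : nat -> nat) : Prop := exists z,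
  [/\ z <= n.+1, base_regs R /\ [/\ R 20 = r.+1 & R 21 = 0],
      [/\ R 15 = idx A0 z, R 16 = idx Q0 z, R 14 = addr slot0 z
        & R 23 = base + 6 * (slot0 z).-1],
      merged z M
    & (r.+1 - idx A0 z) + (r.+1 - idx Q0 z) <= k].

Lemma merged_step z m M M' : z <= m <= n -> N0 m -> (forall y, z <= y < m -> ~~ N0 y) ->
  merged z M ->
  (forall a, a < 6 * r -> M' a = M a) ->
  (forall a, 6 * r <= a < 8 * r -> a != 6 * r + idx A0 m -> M' a = M a) ->
  (forall a, 8 * r <= a < 10 * r -> a != 8 * r + idx Q0 m -> M' a = M a) ->
  (A0 m -> M' (6 * r + idx A0 m) = addr slot0 m) ->
  (Q0 m -> M' (8 * r + idx Q0 m) = addr slot0 m) ->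
  (forall a, base <= a < addr slot0 m -> M' a = M a) ->
  [/\ M' (addr slot0 m + 0) = m, M' (addr slot0 m + 1) = addr slot0 m + 6,
        M' (addr slot0 m + 2) = base + 6 * (slot0 m).-1,
        M' (addr slot0 m + 3) = 0 & M' (addr slot0 m + 4) = 0] ->
  merged m.+1 M'.
Proof.
move=> hzm Nm nN [h1 h2 h3 h4 h5] f1 f2 f3 gA gQ f4 gN.
have old (P : pred nat) x : P x -> (P x -> N0 x) -> x < m.+1 -> x < z \/ x = m.
  move=> Px PN xm; have := nN x; rewrite (PN Px).
  case: (ltnP x z) => h; first by left.
  by case: (ltnP x m) => h'; [move=> /(_ isT) | right; clear -h' xm; lia].
split.
- by apply: static_frame h1 => // a ha; apply: f1; clear -ha; lia.
- move=> q Qq; rewrite f1 ?h2 //.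
  have qn : q <= n by apply: (nodes_le startsP); rewrite /nodes Qq orbT.
  by have := idxQ_le pi qn; clear -r0; lia.
- move=> x Ax xm.
  have [xz|e] := old A0 x Ax ltac:(by rewrite /nodes => ->) xm; last first.
    by rewrite e in Ax *; apply: gA.
  have xm' : x < m by clear -xz hzm; lia.
  have := idx_lt Ax xm'; have : x <= n by clear -xm hzm; lia.
  move=> /(idxA_le pi) l1 l2; rewrite f2 ?h3 //; clear -l1 l2 r0; lia.
- move=> x Qx xm.
  have [xz|e] := old Q0 x Qx ltac:(by rewrite /nodes => ->; rewrite orbT) xm; last first.
    by rewrite e in Qx *; apply: gQ.
  have xm' : x < m by clear -xz hzm; lia.
  have := idx_lt Qx xm'; have : x <= n by clear -xm hzm; lia.
  move=> /(idxQ_le pi) l1 l2; rewrite f3 ?h4 //; clear -l1 l2 r0; lia.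
- move=> x Nx xm.
  have [xz|->] := old N0 x Nx id xm; last by [].
  have xm' : x < m by clear -xz hzm; lia.
  have := idx_lt Nx xm'; rewrite -/(slot0 x) -/(slot0 m) => l.
  have e f : f < 6 -> M' (addr slot0 x + f) = M (addr slot0 x + f).
    by move=> f6; apply: f4; rewrite /node_addr; clear -l f6; lia.
  by rewrite !e //; apply: h5.
Qed.

Lemma merge_body_ok k R M : merge_inv k R M -> R 15 < R 20 ->
  ok merge_body (fun R' M' => exists2 k', k' < k & merge_inv k' R' M') R M.
Proof.
move=> [z [zn [br [R20 R21]] [R15 R16 R14 R23] mg hk]] lt.
have [R0 R4 [R5 R6 R7] R8 R9] := br.
rewrite R15 R20 in lt.
have {}zn : z <= n.
  rewrite -ltnS ltn_neqAle zn andbT; apply: contraTneq lt => ->.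
  by rewrite idxS (bp_n startsP) (idx_starts pi) addn1 ltnn.
have [x [Ax /andP [zx xn] ex nx]] := first_elem zn (bp_n startsP).
have [y [Qy /andP [zy yn] ey ny]] := first_elem zn (outs_n startsP).
have iA : idx A0 z <= r by apply: idxA_le.
have iQ : idx Q0 z <= r by apply: idxQ_le.
have iN : slot0 z <= 3 * r by apply: idxN_le; apply: ltnW.
have qE : addr slot0 z = base + 6 * slot0 z by [].
have [st so _ _ _] := mg; have [s1 _ _] := st.
have Mx : M (idx A0 z + 0) = x by rewrite addn0 -ex s1.
have My : M (idx Q0 z + 4 * r + 0) = y by rewrite addn0 addnC -ey so.
pose m := minn x y.
have hm : z <= m <= n by rewrite /m; clear -zx xn zy yn; lia.
have nN t : z <= t < m -> ~~ N0 t.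
  move=> ht; rewrite /nodes negb_or nx ?ny //; move: ht; rewrite /m; clear; lia.
have Nm : N0 m.
  rewrite /m /nodes; by case: (leqP x y) => h; rewrite ?Ax ?Qy ?orbT.
have same (P : pred nat) : (forall t, P t -> N0 t) -> idx P m = idx P z.
  move=> PN; have [/andP [zm _]] := conj hm I.
  rewrite (elems_catE P zm) size_cat [X in _ + size X](_ : _ = [::]) ?addn0 //.
  rewrite -(filter_pred0 (iota z (m - z))); apply: eq_in_filter => t.
  rewrite mem_iota => ht; apply: contraNF (nN t _); first exact: PN.
  by move: ht; clear -zm; lia.
have eA : idx A0 m = idx A0 z by apply: same => t; rewrite /nodes => ->.
have eQ : idx Q0 m = idx Q0 z by apply: same => t; rewrite /nodes => ->; rewrite orbT.
have eN : slot0 m = slot0 z by apply: same.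
have eAx : A0 m = (x <= y).
  rewrite /m; case: (leqP x y) => // h.
  by apply/negbTE/nx; rewrite zy.
have eQy : Q0 m = (y <= x).
  rewrite /m; case: (leqP y x) => // h.
  by apply/negbTE/ny; rewrite zx.
have fin R' M' :
    (forall i, i \notin [:: 14; 15; 16; 17; 18; 19; 22; 23; 24; 30] -> R' i = R i) ->
    [/\ R' 14 = addr slot0 z + 6, R' 23 = addr slot0 z,
        R' 15 = idx A0 z + (x <= y) & R' 16 = idx Q0 z + (y <= x)] ->
    (forall a, ~~ (addr slot0 z <= a < addr slot0 z + 6) -> a != 6 * r + idx A0 z ->
       a != 8 * r + idx Q0 z -> M' a = M a) ->
    (x <= y -> M' (6 * r + idx A0 z) = addr slot0 z) ->
    (y <= x -> M' (8 * r + idx Q0 z) = addr slot0 z) ->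
    [/\ M' (addr slot0 z + 0) = m, M' (addr slot0 z + 1) = addr slot0 z + 6,
        M' (addr slot0 z + 2) = base + 6 * (slot0 z).-1,
        M' (addr slot0 z + 3) = 0 & M' (addr slot0 z + 4) = 0] ->
    exists2 k', k' < k & merge_inv k' R' M'.
  move=> f [r14 r23 r15 r16] fM gA gQ gN.
  have kp : 0 < k by clear -hk lt; lia.
  exists k.-1; first by rewrite prednK.
  have sS : slot0 m.+1 = (slot0 z).+1.
    by rewrite -eN /slot0 idxS Nm addn1.
  have ad : addr slot0 m = addr slot0 z by rewrite /node_addr eN.
  exists m.+1; split.
  - by case/andP: hm.
  - by split; [split; rewrite ?f //; split; rewrite f|rewrite !f].
  - split.
    + by rewrite r15 idxS eA eAx.
    + by rewrite r16 idxS eQ eQy.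
    + by rewrite r14 /node_addr sS; clear; lia.
    + by rewrite r23 /node_addr sS.
  - apply: (merged_step hm Nm nN mg); rewrite ?eA ?eQ ?ad ?eN ?eAx ?eQy //.
    + by move=> a ha; apply: fM; rewrite ?qE; clear -ha; lia.
    + by move=> a ha hb; apply: fM; rewrite ?qE //; clear -ha iA r0; lia.
    + by move=> a ha hb; apply: fM; rewrite ?qE //; clear -ha iA r0; lia.
    + by move=> a ha; apply: fM; rewrite ?qE; move: ha; rewrite ?qE; clear -iA iQ r0; lia.
  - rewrite !idxS eA eQ eAx eQy; clear -hk lt iQ; case: (leqP x y); case: (leqP y x) => /=; lia.
rewrite /merge_body.
exec; first by rewrite R15; clear -iA r0; lia.
rewrite R15 Mx.
exec; first by rewrite R16 R5; clear -iQ r0 S_le; lia.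
rewrite R16 R5.
exec; first by clear -iQ r0; lia.
rewrite My.
have qS : addr slot0 z + 6 < S by rewrite qE; clear -iN r0; lia.
exec; first by rewrite R14; clear -qS; lia.
exec; first by rewrite R14; clear -qS; lia.
exec; first by rewrite R14; clear -qS S_le; lia.
exec; first by rewrite R14; clear -qS; lia.
exec; first by rewrite R14; clear -qS; lia.
exec; first by [].
rewrite R14 R21 R23.
apply: okT_seq; apply: ok_if; rewrite /cond_eval /cond_regs; regs => c1.
  exec; first by rewrite R14; clear -qS; lia.
  rewrite R14; apply: ok_skip.
  apply: okT_seq; apply: ok_if; rewrite /cond_eval /cond_regs; regs => c2.
    by exfalso; clear -c1 c2; lia.
  exec; first by rewrite R16 R7; clear -iQ S_le r0; lia.
  rewrite R16 R7.
  exec; first by clear -iQ r0; lia.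
  rewrite R14.
  exec; first by rewrite R16; clear -iQ S_le r0; lia.
  rewrite R16; apply: ok_skip; exec => //; apply: ok_skip.
  have e1 : (x <= y) = false by clear -c1; lia.
  have e2 : (y <= x) = true by clear -c1; lia.
  have e3 : m = y by rewrite /m; clear -c1; lia.
  apply: fin; rewrite ?e1 ?e2 ?e3 //; first by frame.
  - by split; regs; rewrite ?addn0.
  - move=> a h1 h2 h3; move: h1 h2 h3; rewrite qE; clear -r0 iQ iA; move=> h1 h2 h3.
    by rd_upd.
  - by move=> _; rewrite qE; clear -r0 iQ iA; rd_upd.
  - by rewrite qE; clear -r0 iQ iA iN; split; rd_upd.
exec; first by rewrite R14; clear -qS; lia.
exec; first by rewrite R15 R6; clear -iA S_le r0; lia.
rewrite R14 R15 R6.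
exec; first by clear -iA r0; lia.
rewrite R14.
exec; first by rewrite R15; clear -iA S_le r0; lia.
rewrite R15; apply: ok_skip.
have e1 : (x <= y) = true by clear -c1; lia.
apply: okT_seq; apply: ok_if; rewrite /cond_eval /cond_regs; regs => c2.
  apply: ok_skip; exec => //; apply: ok_skip.
  have e2 : (y <= x) = false by clear -c2; lia.
  have e3 : m = x by rewrite /m; clear -c2; lia.
  apply: fin; rewrite ?e1 ?e2 ?e3 //; first by frame.
  - by split; regs; rewrite ?addn0.
  - move=> a h1 h2 h3; move: h1 h2 h3; rewrite qE; clear -r0 iQ iA; move=> h1 h2 h3.
    by rd_upd.
  - by move=> _; rewrite qE; clear -r0 iQ iA; rd_upd.
  - by rewrite qE; clear -r0 iQ iA iN; split; rd_upd.
exec; first by rewrite R16 R7; clear -iQ S_le r0; lia.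
rewrite R16 R7.
exec; first by clear -iQ r0; lia.
rewrite R14.
exec; first by rewrite R16; clear -iQ S_le r0; lia.
rewrite R16; apply: ok_skip; exec => //; apply: ok_skip.
have e2 : (y <= x) = true by clear -c2; lia.
have e3 : m = x by rewrite /m; clear -c1 c2; lia.
apply: fin; rewrite ?e1 ?e2 ?e3 //; first by frame.
- move=> a h1 h2 h3; move: h1 h2 h3; rewrite qE; clear -r0 iQ iA; move=> h1 h2 h3.
  by rd_upd.
- by move=> _; rewrite qE; clear -r0 iQ iA; rd_upd.
- by move=> _; rewrite qE; clear -r0 iQ iA; rd_upd.
- by rewrite qE; clear -r0 iQ iA iN; split; rd_upd.
Qed.

Lemma merge_done k R M : merge_inv k R M -> ~~ (R 15 < R 20) ->
  [/\ base_regs R, R 14 = base + 6 * idx N0 n.+1, R 23 = addr slot0 n & merged n.+1 M].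
Proof.
move=> [z [zn [br [R20 R21]] [R15 R16 R14 R23] mg hk]]; rewrite R15 R20 => nlt.
have zE : z = n.+1.
  apply/eqP; rewrite eqn_leq zn ltnNge; apply/negP => h; case/negP: nlt.
  by rewrite ltnS; apply: idxA_le.
have Nn : N0 n by rewrite /nodes (bp_n startsP).
split=> //; first by rewrite R14 zE.
  by rewrite R23 zE /slot0 idxS Nn addn1.
by rewrite -zE.
Qed.

Lemma merged_rep M : merged n.+1 M -> rep N0 pred0 slot0 (idx N0 n.+1) M.
Proof.
move=> [_ _ _ _ h].
have lt x : N0 x -> x < n.+1 by move=> /(nodes_le startsP); rewrite ltnS.
have nx x y : N0 x -> is_next N0 x y -> slot0 y = (slot0 x).+1.
  by move=> Nx [xy _ g]; rewrite /slot0 (elems_gap xy g) idxS Nx addn1.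
split.
- move=> x y Nx Ny e; case: (ltngtP x y) => // l.
  + by have := idx_lt Nx l; move: e; rewrite /slot0 => ->; rewrite ltnn.
  + by have := idx_lt Ny l; move: e; rewrite /slot0 => ->; rewrite ltnn.
- by move=> x Nx; apply: idx_lt => //; apply: lt.
- by move=> x Nx; case: (h x Nx (lt x Nx)).
- move=> x y Nx nxy; case: (h x Nx (lt x Nx)) => _ -> _ _ _.
  by rewrite /node_addr (nx x y Nx nxy); lia.
- move=> x y Nx nxy; have [_ Ny _] := nxy; case: (h y Ny (lt y Ny)) => _ _ -> _ _.
  by rewrite /node_addr (nx x y Nx nxy).
- by move=> x Nx; case: (h x Nx (lt x Nx)).
- by move=> x Nx; case: (h x Nx (lt x Nx)).
- by [].
Qed.

Definition linked (z : nat) : pred nat := fun x => A0 x && ((x < z) || (x == n)).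

Record tables (M : nat -> nat) : Prop := Tables {
  tb_static : static M;
  tb_in : forall x, A0 x -> M (6 * r + idx A0 x) = addr slot0 x;
  tb_out : forall x, Q0 x -> M (8 * r + idx Q0 x) = addr slot0 x }.

Lemma tables_frame M M' : (forall a, a < 10 * r -> M' a = M a) -> tables M -> tables M'.
Proof.
move=> e [h1 h2 h3]; split.
- by apply: static_frame h1 => // a ha; apply: e; clear -ha; lia.
- move=> x Ax; rewrite e ?h2 //; have := idxA_le pi (bp_le startsP Ax); clear -r0; lia.
- move=> x Qx; rewrite e ?h3 //.
  have xn : x <= n by apply: (nodes_le startsP); rewrite /nodes Qx orbT.
  by have := idxQ_le pi xn; clear -r0; lia.
Qed.

Lemma merged_tables M : merged n.+1 M -> tables M.
Proof.
move=> [h1 _ h3 h4 _]; split=> // x Px; [apply: h3 | apply: h4] => //; rewrite ltnS.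
- exact: bp_le startsP x Px.
- by apply: (nodes_le startsP); rewrite /nodes Px orbT.
Qed.

Definition link_inv (k : nat) (R M : nat -> nat) : Prop := exists z,
  [/\ A0 z && (z <= n),
      [/\ R 0 = r, R 4 = n, R 6 = 6 * r, R 7 = 8 * r & R 9 = 10 * r] /\
      (R 16 = idx A0 z /\ R 14 = base + 6 * idx N0 n.+1),
      rep N0 (linked z) slot0 (idx N0 n.+1) M /\ tables M,
      stack (elems A0 z) A0 slot0 R M & r - idx A0 z <= k].

Lemma link_body_ok k R M : link_inv k R M -> R 16 < R 0 ->
  ok link_body (fun R' M' => exists2 k', k' < k & link_inv k' R' M') R M.
Proof.
move=> [z [/andP [Az zn] [[R0 R4 R6 R7 R9] [R16 R14]] [hr tb] hs hk]] lt.
rewrite R16 R0 in lt.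
have zlt : z < n.
  rewrite ltn_neqAle zn andbT; apply: contraTneq lt => ->.
  by rewrite idx_starts ltnn.
have [[s1 s2 s3] t1 t2] := tb; have [R8 sM sE] := hs.
have Qh : Q0 (hat pi z) by rewrite outs_hat.
have hl : idx Q0 (hat pi z) <= r by apply: idxQ_le; rewrite hat_le.
have Nz : N0 z by rewrite /nodes Az.
have Nh : N0 (hat pi z) by rewrite /nodes Qh orbT.
have iN x : N0 x -> slot0 x < 3 * r.
  move=> Nx; have xn := nodes_le startsP Nx.
  by apply: leq_trans (idxN_le (leqnn n.+1)); apply: idx_lt.
have lz := iN _ Nz; have lh := iN _ Nh.
have [z' [Az' zz' ez' nz']] := first_elem (z := z.+1) zlt (bp_n startsP).
rewrite /link_body.
exec; first by rewrite R16 R6; clear -lt r0 S_le; lia.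
rewrite R16 R6.
exec; first by clear -lt r0; lia.
rewrite addn0 [idx A0 z + _]addnC t1 //.
exec; first by rewrite R16 R0; clear -lt S_le; lia.
rewrite R16 R0.
exec; first by rewrite R0; clear -lt S_le; lia.
rewrite R0.
exec; first by clear -lt; lia.
have -> : idx A0 z + r + r + 1 = 2 * r + 1 + idx A0 z by clear; lia.
rewrite s3 //.
exec; first by rewrite R7; clear -hl r0 S_le; lia.
rewrite R7.
exec; first by clear -hl r0; lia.
rewrite addn0 [idx Q0 _ + _]addnC t2 //.
exec; first by rewrite /node_addr; clear -lz r0; lia.
exec; first by rewrite /node_addr; clear -lh r0; lia.
exec; first by rewrite R8; clear -lt; lia.
rewrite R8.
exec; first by rewrite R8; clear -lt S_le; lia.
rewrite R8.
exec; first by rewrite R16; clear -lt S_le; lia.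
rewrite R16.
apply: ok_skip; exists k.-1; first by clear -lt hk; lia.
have ea : elems A0 z' = rcons (elems A0 z) z by rewrite ez' elems_rcons Az.
exists z'; split.
- by rewrite Az'; case/andP: zz'.
- by split=> //; split; regs => //; rewrite ea size_rcons addn1.
- split.
    apply: (rep_frame (m := upd (upd M (addr slot0 z + 3) (addr slot0 (hat pi z)))
       (addr slot0 (hat pi z) + 4) (addr slot0 z))).
      by move=> a ha; rewrite upd_diff //; clear -ha lt; lia.
    apply: rep_eq (rep_link hr Nz Nh) => // x.
    rewrite /linked; case: (eqVneq x z) => [->|xz].
      by rewrite Az orbT; case/andP: zz' => -> _.
    rewrite orbF; case: (boolP (A0 x)) => //= Ax; congr (_ || _).
    apply/idP/idP => h; first by clear -h zz'; lia.
    have := nz' x; rewrite Ax; case: (ltngtP x z) xz => // c _.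
    by rewrite h => /(_ isT).
  apply: tables_frame tb => a ha; rewrite !upd_diff //; clear -ha r0; rewrite /node_addr; lia.
- split.
  + by regs; rewrite ea size_rcons addn1 -addnS.
  + move=> i; rewrite ea size_rcons nth_rcons => hi.
    have [il|->] : i < idx A0 z \/ i = idx A0 z by clear -hi; lia.
      rewrite il !upd_diff ?sM //; clear -il lt; rewrite /node_addr; lia.
    by rewrite ltnn eqxx addn0 upd_same.
  + by move=> c; rewrite ea mem_rcons inE => /orP [/eqP ->|/sE].
- by rewrite ea size_rcons; clear -hk lt; lia.
Qed.

Lemma link_done k R M : link_inv k R M -> ~~ (R 16 < R 0) -> main_inv (7 * r) R M.
Proof.
move=> [z [/andP [Az zn] [[R0 R4 R6 R7 R9] [R16 R14]] [hr tb] hs hk]].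
rewrite R16 R0 => nlt.
have zE : z = n.
  apply/eqP; rewrite eqn_leq zn leqNgt; apply/negP => h; case/negP: nlt.
  exact: idxA_lt.
rewrite zE in hr hs; exists A0, slot0, (elems A0 n); split=> //.
- rewrite /heap -!size_elems; split=> //; first exact: start_charged.
    exact: cnt_start.
  apply: rep_eq hr => // x; rewrite /linked; case: (boolP (A0 x)) => //= Ax.
  by have := bp_le startsP Ax; rewrite leq_eqVlt orbC.
- by move=> c Ac cn _; rewrite mem_elems Ac.
- rewrite -size_elems idxS (bp_n startsP) (idx_starts pi); clear; lia.
Qed.

Definition init_time : nat :=
  csize init_setup + (r.+1 * csize (While (CLt 16 0) sort_body) +
  (csize merge_setup + ((2 * r.+1).+1 * csize (While (CLt 15 20) merge_body) +
  (csize link_setup + r.+1 * csize (While (CLt 16 0) link_body))))).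

Lemma initialise_ok R M : R 0 = r -> static M ->
  okT w S initialise init_time (main_inv (7 * r)) R M.
Proof.
move=> R0 st; have [s1 _ _] := st.
have M_n : M (r + 0) = n by rewrite addn0 -{1}(idx_starts pi) s1 ?(bp_n startsP).
have A00 : A0 0 by apply: (bp_0 startsP n0).
apply: okT_seq.
apply: (ok_weak (leqnn _) _ (_ : ok init_setup (sort_inv r) R M)); last first.
  rewrite /init_setup.
  do 4 (exec; first by rewrite R0; clear -S_le r0; lia).
  rewrite R0; exec => //; exec; first by rewrite R0; clear -S_le r0; lia.
  rewrite R0; exec; first by rewrite R0; clear -r0; lia.
  rewrite R0 M_n; exec; first by rewrite R0; clear -S_le r0; lia.
  rewrite R0; exec; first by clear -r0; lia.
  exec; first by clear -S_le r0; lia.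
  apply: ok_skip; exists 0; split=> //.
  - by rewrite A00.
  - by split=> //; [split|..]; regs; rewrite mulnC.
  - by split=> //; regs; rewrite mulnC.
  - split; last by rewrite upd_at //; clear; lia.
    by apply: static_frame st => // a ha; rewrite upd_diff //; clear -ha r0; lia.
  - by split=> //=; rewrite subn0.
move=> R1 M1 inv1; apply: okT_seq.
apply: (ok_weak (leqnn _) _ (okT_while (I := sort_inv) _ inv1)); last first.
  by move=> k' R' M' hi /= lt; apply: sort_body_ok.
move=> R2 M2 [k2 [R2' [hi /= nlt ->]]].
have [br r14 st2 so] := sort_done hi nlt; have [q0 q4 [q5 q6 q7] q8 q9] := br.
apply: okT_seq.
apply: (ok_weak (leqnn _) _ (_ : ok merge_setup (merge_inv (2 * r.+1)) R2' M2)); last first.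
  rewrite /merge_setup.
  do 2 (exec; first by clear -S_le r0; lia).
  exec; first by rewrite q0; clear -S_le r0; lia.
  exec; first by clear -S_le r0; lia.
  exec => //; rewrite q0; apply: ok_skip; exists 0; split=> //.
  - by split=> //; split; regs; rewrite ?addn1.
  - by rewrite r14; split=> //; regs; rewrite ?r14 /node_addr muln0 addn0.
  - by clear; lia.
move=> R3 M3 inv3; apply: okT_seq.
apply: (ok_weak (leqnn _) _ (okT_while (I := merge_inv) _ inv3)); last first.
  by move=> k' R' M' hi' /= lt; apply: merge_body_ok.
move=> R4 M4 [k4 [R4' [hi4 /= nlt4 ->]]].
have [br4 p14 p23 mg] := merge_done hi4 nlt4; have [p0 p4 [p5 p6 p7] p8 p9] := br4.
have Nn : N0 n by rewrite /nodes (bp_n startsP).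
have ln : slot0 n < 3 * r.
  by apply: leq_trans (idxN_le (leqnn n.+1)); apply: idx_lt.
have rp := merged_rep mg; have tb := merged_tables mg.
apply: okT_seq.
apply: (ok_weak (leqnn _) _ (_ : ok link_setup (link_inv r) R4' M4)); last first.
  rewrite /link_setup.
  exec; first by rewrite p23 /node_addr; clear -ln; lia.
  exec; first by rewrite p23 /node_addr; clear -ln; lia.
  exec; first by clear -S_le r0; lia.
  rewrite p23; apply: ok_skip; exists 0; split=> //.
  - by rewrite A00.
  - split.
      have Nhn : N0 (hat pi n) by rewrite hat_n.
      have := rep_link rp Nn Nhn; rewrite hat_n.
      apply: rep_eq => // x; rewrite /linked /=.
      by case: eqP => [->|]; rewrite ?(bp_n startsP) ?andbF.
    by apply: tables_frame tb => a ha; rewrite !upd_diff //; clear -ha r0; rewrite /node_addr; lia.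
  - by split=> //; regs; rewrite p8 addn0.
  - by rewrite subn0.
move=> R5 M5 inv5.
apply: (ok_weak (leqnn _) _ (okT_while (I := link_inv) _ inv5)); last first.
  by move=> k' R' M' hi' /= lt; apply: link_body_ok.
by move=> R6 M6 [k6 [R6' [hi6 /= nlt6 ->]]]; apply: link_done hi6 nlt6.
Qed.

End Program.

Lemma word_size_bounds n (pi : 'S_n) w : 7 * (trunc_log 2 n).+1 <= w ->
  64 * nb_intervals pi <= 2 ^ w /\ n < 2 ^ w.
Proof.
move=> hw; have h := trunc_log_ltn n (isT : 1 < 2).
have h2 : 64 * 2 ^ (trunc_log 2 n).+1 <= 2 ^ w.
  by rewrite -(expnD 2 6) leq_exp2l //; lia.
have rn : nb_intervals pi <= n.
  by rewrite /nb_intervals size_filter; apply: leq_trans (count_size _ _) _; rewrite size_iota.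
by split; lia.
Qed.

Lemma nb_intervals_gt0 n (pi : 'S_n) : 0 < n -> 0 < nb_intervals pi.
Proof.
move=> n0; rewrite /nb_intervals -has_predT; apply/hasP; exists 0 => //.
by rewrite mem_filter mem_iota.
Qed.

Lemma move_cmd_ok alpha n (pi : 'S_n) w R M :
  2 <= alpha -> 0 < n -> 7 * (trunc_log 2 n).+1 <= w ->
  R 0 = nb_intervals pi -> array_at M 0 (P_arr pi ++ Ppi_arr pi ++ tau_arr pi) ->
  okT w (64 * nb_intervals pi) move_cmd (40 * csize move_cmd * nb_intervals pi)
    (fun R' M' => forall pc,
       output_state (64 * nb_intervals pi) alpha 3 pi (State pc R' M')) R M.
Proof.
move=> ha n0 hw R0 hM.
have r0 := nb_intervals_gt0 pi n0; have [S_le n_lt] := word_size_bounds pi hw.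
set r := nb_intervals pi in R0 r0 S_le *.
pose T := init_time pi + ((7 * r).+1 * csize (While (CLt 9 8) main_body) + output_time pi).
have leT : T <= 40 * csize move_cmd * r.
  rewrite /T /init_time /output_time -/r; clear -r0.
  repeat match goal with |- context [csize ?c] =>
    let v := eval vm_compute in (csize c) in change (csize c) with v end.
  lia.
apply: (ok_weak leT (fun R' M' h => h)).
apply: okT_seq; apply: (ok_weak (leqnn _) _ (initialise_ok n0 r0 S_le n_lt R0 (static_input hM))).
move=> R1 M1 inv1; apply: okT_seq.
apply: (ok_weak (leqnn _) _ (main_loop_ok n0 r0 S_le n_lt inv1)).
move=> R2 M2 [A [slot [h0 h4 hh nc]]].
have le5 := heap_le r0 hh; have [hA wc le hr _] := hh.
have cb := count_breakpoints hA wc le.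
have le3 : size (elems A n) <= 3 * r.
  by move: cb; rewrite -size_elems elems_rcons (bp_n hA) size_rcons ltnS.
apply: (ok_weak (leqnn _) _ (output_ok n0 r0 S_le n_lt hA le5 le3 h0 h4 hr)).
move=> R3 M3 [q0 [q1 q2 q3] a1 a2 a3] pc.
exists (elems A n), (image_of pi (elems A n)), [seq rank_of A (hat pi x) | x <- elems A n].
split=> /=.
- by apply: bms_of => //; rewrite -size_elems.
- exact: q0.
- by rewrite q1 size_rcons; split=> //; clear -le3 r0; lia.
- by rewrite q2 image_elems size_map; split=> //; clear -le3 r0; lia.
- by rewrite q3 size_map; split=> //; clear -le3 r0; lia.
Qed.

Theorem theorem26 (alpha : nat) (halpha : 2 <= alpha) :
  exists (prog : program) (cw ct cs cr : nat),
  forall (n : nat) (pi : 'S_n) (w : nat) (st : state),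
    0 < n ->
    cw * (trunc_log 2 n).+1 <= w ->
    input_state w pi st ->
    exists (t : nat) (st' : state),
      [/\ t <= ct * nb_intervals pi,
          steps w (cs * nb_intervals pi) prog t st = Some st',
          halted prog st'
        & output_state (cs * nb_intervals pi) alpha cr pi st'].
Proof.
exists (compile 0 move_cmd), 7, (40 * csize move_cmd), 64, 3.
move=> n pi w [pc R M] n0 hw [_ /= -> R0 hM].
have hwf : wf move_cmd by vm_compute.
have hc : code_at (compile 0 move_cmd) 0 (compile 0 move_cmd).
  by exists [::], [::]; rewrite cats0.
have [t [R' [M' [h1 h2 h3]]]] := move_cmd_ok halpha n0 hw R0 hM hwf hc.
exists t, (State (0 + csize move_cmd) R' M'); split=> //.
Qed.
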